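(* Fix $0<\alpha<1$. There exist a constant $C=C(\alpha)$ and $n_0=n_0(\alpha)$ such that for any $n\ge n_0$, if a graph $F$ on $n$ vertices contains at least $\alpha\cdot m(n)$ induced cycles, then by adding or deleting edges incident to at most $C(\alpha)$ vertices of $F$, the graph $F$ can be transformed into a cyclic braid with the same cluster sizes as $H_n$.
   Context: All graphs are finite and simple. $m(n)$ denotes the maximum number of induced cycles (of any length $\ge 3$) that can be contained in a graph on $n$ vertices. $N_B(x)$ denotes the neighbourhood of $x$ in $B$. A graph $B$ is a cyclic braid if there exist $k\ge 3$ and a partition $B_1,\dots,B_k$ of $V(B)$ such that for every $1\le i\le k$ and every $x\in B_i$ we have $B_{i-1}\cup B_{i+1}\subseteq N_B(x)\subseteq B_{i-1}\cup B_i\cup B_{i+1}$, indices modulo $k$. The sets $B_i$ are the clusters, and $k$ is the length. Edges inside clusters are allowed. A cyclic braid is empty if it has no edges inside its clusters. For $n\ge 8$ the $n$-vertex graph $H_n$ is defined as follows, where $k\ge 3$: $H_{3k}$ is the empty cyclic braid of length $k$ in which every cluster has size 3; $H_{3k+1}$ is the empty cyclic braid of length $k$ with $k-1$ clusters of size 3 and one cluster of size 4; $H_{3k-1}$ is the empty cyclic braid of length $k$ with $k-1$ clusters of size 3 and one cluster of size 2. *)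

(* Defs.v *)
From HB Require Import structures.
From mathcomp Require Import all_boot zify.

Set Implicit Arguments.
Unset Strict Implicit.
Unset Printing Implicit Defensive.

Section SimpleGraphs.
Variable V : finType.

Definition simple_adj (a : {ffun V * V -> bool}) : bool :=
  [forall x, ~~ a (x, x)] && [forall x, forall y, a (x, y) == a (y, x)].

Record sgraph : Type := SGraph { sgraph_adj : {ffun V * V -> bool};
                                 sgraph_simple : simple_adj sgraph_adj }.

HB.instance Definition _ := [isSub for sgraph_adj].
HB.instance Definition _ := [Finite of sgraph by <:].

Definition adjacent (G : sgraph) : rel V := fun x y => sgraph_adj G (x, y).
Coercion adjacent : sgraph >-> rel.

Lemma adjacent_irrefl (G : sgraph) : irreflexive G.
Proof.
by move=> x; apply: negbTE; case: G => a aG; have /andP[/forallP/(_ x)] := aG.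
Qed.

Lemma adjacent_sym (G : sgraph) : symmetric G.
Proof.
move=> x y; case: G => a aG.
by have /andP[_ /forallP/(_ x)/forallP/(_ y)/eqP] := aG.
Qed.

Fact graph_of_simple (r : rel V) :
  simple_adj [ffun p => (p.1 != p.2) && (r p.1 p.2 || r p.2 p.1)].
Proof.
apply/andP; split; first by apply/forallP => x; rewrite ffunE eqxx.
apply/forallP => x; apply/forallP => y.
by apply/eqP; rewrite !ffunE /= eq_sym orbC.
Qed.

(* The symmetric, loopless closure of r. *)
Definition graph_of (r : rel V) : sgraph := SGraph (graph_of_simple r).

Lemma graph_ofE (r : rel V) x y :
  graph_of r x y = (x != y) && (r x y || r y x).
Proof. by rewrite /adjacent ffunE. Qed.

Definition nbh (G : sgraph) (x : V) : {set V} := [set y | G x y].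

End SimpleGraphs.

(* [ordS] is the successor modulo k, so this is C_k when 3 <= k. *)
Definition cycle_graph (k : nat) : sgraph 'I_k :=
  graph_of (fun i j => j == ordS i).

Definition induces_cycle (V : finType) (G : sgraph V) (S : {set V}) : bool :=
  (3 <= #|S|) &&
  [exists f : {ffun 'I_#|S| -> V},
    [&& injectiveb f, f @: [set: 'I_#|S|] == S
      & [forall i, forall j, G (f i) (f j) == cycle_graph #|S| i j]]].

(* An induced cycle is determined by its vertex set, so counting vertex sets
   counts induced cycles. *)
Definition num_induced_cycles (V : finType) (G : sgraph V) : nat :=
  #|[set S : {set V} | induces_cycle G S]|.

Definition max_induced_cycles (n : nat) : nat :=
  \max_(G : sgraph 'I_n) num_induced_cycles G.

Section CyclicBraids.
Variables (V : finType) (k : nat).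

Definition clusters_partition (B : 'I_k -> {set V}) : Prop :=
  injective B /\ partition [set B i | i : 'I_k] [set: V].

Definition cyclic_braid_with (G : sgraph V) (B : 'I_k -> {set V}) : Prop :=
  [/\ 3 <= k, clusters_partition B
    & forall (i : 'I_k) (x : V), x \in B i ->
        B (ord_pred i) :|: B (ordS i) \subset nbh G x /\
        nbh G x \subset B (ord_pred i) :|: B i :|: B (ordS i)].

Definition empty_cyclic_braid_with (G : sgraph V) (B : 'I_k -> {set V}) :
    Prop :=
  cyclic_braid_with G B /\
  forall (i : 'I_k) (x y : V), x \in B i -> y \in B i -> ~~ G x y.

Definition cluster_sizes (B : 'I_k -> {set V}) : seq nat :=
  [seq #|B i| | i : 'I_k].

End CyclicBraids.

(* The length is k when n is 3k - 1, 3k or 3k + 1. *)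
Definition H_length (n : nat) : nat := n.+1 %/ 3.

(* Cluster 0 is the one whose size may differ from 3. *)
Definition H_size (n i : nat) : nat :=
  if i == 0 then
    match n %% 3 with 0 => 3 | 1 => 4 | _ => 2 end
  else 3.

Definition H_vertex (n : nat) : finType :=
  {i : 'I_(H_length n) & 'I_(H_size n i)}.

Definition H_graph (n : nat) : sgraph (H_vertex n) :=
  graph_of (fun x y : H_vertex n => tag y == ordS (tag x)).

Definition H_cluster (n : nat) (i : 'I_(H_length n)) : {set H_vertex n} :=
  [set x | tag x == i].
Arguments H_cluster : clear implicits.

Lemma card_H_cluster n i : #|H_cluster n i| = H_size n i.
Proof.
rewrite -[RHS]card_ord -cardsT.
have inj : injective (fun u : 'I_(H_size n i) => Tagged _ u : H_vertex n).
  by move=> u v; exact: eq_from_Tagged.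
rewrite -(card_imset _ inj); apply: eq_card => x; rewrite inE.
apply/eqP/imsetP => [|[u _ ->] //].
by case: x => j u /= ej; subst j; exists u.
Qed.

Lemma card_H_vertex n : 8 <= n -> #|{: H_vertex n}| = n.
Proof.
move=> n8; rewrite card_tagged sumnE big_map big_enum /=.
under eq_bigr do rewrite card_ord.
have [l Hl] : exists l, H_length n = l.+1.
  by exists (H_length n).-1; rewrite /H_length; lia.
rewrite Hl big_ord_recl (eq_bigr (fun=> 3)) // sum_nat_const card_ord.
move: Hl; rewrite /H_length /H_size /=.
case: (n %% 3) (divn_eq n 3) (ltn_pmod n (isT : 0 < 3)) => [|[|[|//]]]; lia.
Qed.

Lemma ordS_neq k (i : 'I_k) : 1 < k -> ordS i != i.
Proof.
move=> k2; apply/eqP => /(congr1 val) /=.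
have := ltn_ord i; rewrite leq_eqVlt => /orP[/eqP ek|lt].
  by rewrite ek modnn => e0; rewrite -ek -e0 in k2.
by rewrite modn_small // => /eqP; rewrite eqn_leq ltnn.
Qed.

Lemma H_empty_cyclic_braid n :
  8 <= n -> empty_cyclic_braid_with (H_graph n) (H_cluster n).
Proof.
move=> n8; have k3 : 3 <= H_length n by rewrite leq_divRL.
have inh i : exists x, x \in H_cluster n i.
  apply/set0Pn; rewrite -card_gt0 card_H_cluster /H_size.
  by case: eqP => // _; case: (n %% 3) => [|[|]].
have predE (i j : 'I_(H_length n)) : (i == ordS j) = (ord_pred i == j).
  by rewrite (can2_eq (@ord_predK _) (@ordSK _)).
have selfS (i : 'I_(H_length n)) : (i == ordS i) = false.
  by rewrite eq_sym; apply/negbTE/ordS_neq/ltnW.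
have HE (x y : H_vertex n) :
    H_graph n x y = (tag y == ordS (tag x)) || (tag y == ord_pred (tag x)).
  rewrite graph_ofE [tag y == ord_pred _]eq_sym -predE andb_idl // => xy.
  by apply: contraTneq xy => ->; rewrite orbb selfS.
split=> [|i x y]; last first.
  rewrite !inE HE => /eqP-> /eqP->.
  by rewrite [_ == ord_pred _]eq_sym -predE selfS.
split=> //; last first.
  move=> i x; rewrite inE => /eqP ex; split; apply/subsetP=> y.
    by rewrite !inE HE ex orbC.
  by rewrite !inE HE ex => /orP[->|->]; rewrite ?orbT.
split.
  move=> i j eB; have [x xi] := inh i.
  by have := xi; rewrite eB !inE => /eqP <-; move: xi; rewrite inE => /eqP.
apply/and3P; split.
- apply/eqP/setP=> x; rewrite inE; apply/bigcupP.
  by exists (H_cluster n (tag x)); rewrite ?imset_f // inE.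
- apply/trivIsetP => _ _ /imsetP[i _ ->] /imsetP[j _ ->] nij.
  rewrite -setI_eq0; apply/eqP/setP=> x; rewrite !inE.
  apply/andP=> -[/eqP ei /eqP ej]; case/eqP: nij.
  by rewrite -ei -ej.
- by apply/imsetP => -[i _ e0]; have [x] := inh i; rewrite -e0 inE.
Qed.

(* Main.v *)
Require Import Defs.
From mathcomp Require Import all_boot all_order all_algebra.
From mathcomp Require Import reals lra ring zify.
Import Order.TTheory GRing.Theory Num.Theory.
(* Explore the induced cycles through a fixed path a - v - b by growing an
   induced path from a: from the end x one moves to one of the d neighbours of
   x still available and then deletes all d of them.  With theta^3 = 3 we have
   d <= theta^d, with equality only for d = 3, so there are at most theta^r
   completions inside r available vertices, and every step with d <> 3 loses a
   constant factor.  As F has a positive proportion of theta^n cycles, the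
   number of irregular steps, averaged over the cycles, is bounded (a step is
   also irregular if one of its children is, or if the completions are spread
   unfairly over the children).

   It remains to see that at most regular steps the three children y have the
   same three available neighbours.  Suppose y1 has the available
   neighbourhood T, and y2 another one.  Continue through y2 while avoiding T;
   fair regular steps give this a probability bounded below.  The last vertex
   of T to be deleted then keeps fewer available neighbours than it has on the
   path through y1, where that number is 3; so an irregular step occurs when T
   is hit.  A vertex lies in at most six such sets T, so these conflicts are
   charged a bounded number of times to irregular steps.  Hence some cycle has
   boundedly many bad steps, and the sets deleted at its other steps are
   consecutive clusters of a braid. *)

Set Implicit Arguments.
Unset Strict Implicit.
Unset Printing Implicit Defensive.
Local Open Scope ring_scope.

(** * The tree of induced paths and weighted sums over it *)

Section Exploration.
Variables (R : rcfType) (V : finType) (G : sgraph V) (b : V).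
Implicit Types (x y v : V) (D E F T : {set V}) (Ts : seq {set V}) (p : V * V).

Definition nb x D : {set V} := nbh G x :&: D.
Definition rest x D : {set V} := D :\: nbh G x.

Lemma in_nb x D y : (y \in nb x D) = G x y && (y \in D).
Proof. by rewrite /nb !inE. Qed.

Lemma in_rest x D y : (y \in rest x D) = ~~ G x y && (y \in D).
Proof. by rewrite /rest !inE. Qed.

Lemma card_nb_rest x D : (#|D| = #|nb x D| + #|rest x D|)%N.
Proof. by rewrite -(cardsID (nbh G x) D) setIC. Qed.

Lemma card_rest_lt x D y : y \in nb x D -> (#|rest x D| < #|D|)%N.
Proof.
by move=> yx; rewrite (card_nb_rest x D) -add1n leq_add2r card_gt0; apply/set0Pn; exists y.
Qed.

Lemma rest_sub x D : rest x D \subset D.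
Proof. exact: subsetDl. Qed.

Lemma tree_ind (P : V -> {set V} -> Prop) :
  (forall x D, (forall y, y \in nb x D -> P y (rest x D)) -> P x D) ->
  forall x D, P x D.
Proof.
move=> step x D; have [n] := ubnP #|D|; elim: n x D => // n IHn x D leDn.
by apply: step => y /card_rest_lt ltD; apply: IHn; apply: leq_trans ltD _.
Qed.

(* A state (x, D) is an induced path ending at x, D being the set of vertices
   that may still be used; it is complete when x is adjacent to the target b.
   The children in F are skipped, and n is fuel, sufficient once #|D| <= n. *)
Fixpoint tree_sum_rec n F (lf nd : V -> {set V} -> R) x D : R :=
  if G x b then lf x D else
  nd x D + (if n is n'.+1 then
              \sum_(y in nb x D | y \notin F) tree_sum_rec n' F lf nd y (rest x D)
            else 0).

Definition tree_sum F lf nd x D := tree_sum_rec #|D| F lf nd x D.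

Lemma tree_sum_rec_fuel n F lf nd x D :
  (#|D| <= n)%N -> tree_sum_rec n F lf nd x D = tree_sum F lf nd x D.
Proof.
suff fuel m : (#|D| <= n)%N -> (#|D| <= m)%N ->
    tree_sum_rec n F lf nd x D = tree_sum_rec m F lf nd x D by move=> leDn; exact: fuel.
elim: n m x D => [|n IHn] [|m] x D leDn leDm //=; case: ifP => // _; congr (_ + _).
- by rewrite big1 // => y /andP[/card_rest_lt]; lia.
- by rewrite big1 // => y /andP[/card_rest_lt]; lia.
by apply: eq_bigr => y /andP[/card_rest_lt ltD _]; apply: IHn; lia.
Qed.

Lemma tree_sumE F lf nd x D :
  tree_sum F lf nd x D =
    if G x b then lf x D else
    nd x D + \sum_(y in nb x D | y \notin F) tree_sum F lf nd y (rest x D).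
Proof.
rewrite -(tree_sum_rec_fuel F lf nd x (leqnSn _)) /=; case: ifP => // _; congr (_ + _).
by apply: eq_bigr => y /andP[/card_rest_lt ltD _]; rewrite tree_sum_rec_fuel // ltnW.
Qed.

Lemma tree_sum_le F lf nd lf' nd' :
  (forall x D, G x b -> lf x D <= lf' x D) ->
  (forall x D, ~~ G x b -> nd x D <= nd' x D) ->
  forall x D, tree_sum F lf nd x D <= tree_sum F lf' nd' x D.
Proof.
move=> le_lf le_nd; apply: tree_ind => x D IH; rewrite !tree_sumE.
case: ifPn => [|xb]; first exact: le_lf.
apply: lerD; first exact: le_nd.
by apply: ler_sum => y /andP[yx _]; exact: IH.
Qed.

Lemma tree_sum_ge0 F lf nd :
  (forall x D, 0 <= lf x D) -> (forall x D, 0 <= nd x D) ->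
  forall x D, 0 <= tree_sum F lf nd x D.
Proof.
move=> lf0 nd0; apply: tree_ind => x D IH; rewrite tree_sumE; case: ifP => // _.
by apply: addr_ge0 => //; apply: sumr_ge0 => y /andP[yx _]; exact: IH.
Qed.

Lemma tree_sumD F lf nd lf' nd' x D :
  tree_sum F (fun x D => lf x D + lf' x D) (fun x D => nd x D + nd' x D) x D =
  tree_sum F lf nd x D + tree_sum F lf' nd' x D.
Proof.
move: x D; apply: tree_ind => x D IH; rewrite !tree_sumE; case: ifP => // _.
rewrite addrACA -big_split /=; congr (_ + _).
by apply: eq_bigr => y /andP[yx _]; exact: IH.
Qed.

Lemma tree_sumZ F c lf nd x D :
  tree_sum F (fun x D => c * lf x D) (fun x D => c * nd x D) x D =
  c * tree_sum F lf nd x D.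
Proof.
move: x D; apply: tree_ind => x D IH; rewrite !tree_sumE; case: ifP => // _.
rewrite mulrDr mulr_sumr; congr (_ + _).
by apply: eq_bigr => y /andP[yx _]; exact: IH.
Qed.

Local Notation usum := (tree_sum set0).

Lemma usumE lf nd x D :
  usum lf nd x D =
    if G x b then lf x D else
    nd x D + \sum_(y in nb x D) usum lf nd y (rest x D).
Proof.
by rewrite tree_sumE; under eq_bigl => y do rewrite in_set0 andbT.
Qed.

(** A potential that dominates the leaf weights and, at each inner node, covers the node weight plus
    the potentials of the children survives the induction from the leaves up. The counting bounds
    below are obtained by choosing [phi]. *)
Lemma usum_potential lf nd phi :
  (forall x D, G x b -> lf x D <= phi x D) ->
  (forall x D, ~~ G x b ->
     nd x D + \sum_(y in nb x D) phi y (rest x D) <= phi x D) ->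
  forall x D, usum lf nd x D <= phi x D.
Proof.
move=> le_lf le_nd; apply: tree_ind => x D IH; rewrite usumE.
case: ifPn => [|xb]; first exact: le_lf.
apply: le_trans (le_nd x D xb); rewrite lerD2l.
by apply: ler_sum => y yx; exact: IH.
Qed.

(** Every node except the root is a child of exactly one node. This transfers a weight for having a
    bad child to the child itself. *)
Lemma usum_children g x D :
  usum (fun _ _ => 0) (fun x D => \sum_(y in nb x D) g y (rest x D)) x D +
    g x D = usum g g x D.
Proof.
move: x D; apply: tree_ind => x D IH; rewrite !usumE.
case: ifP => _; first by rewrite add0r.
rewrite addrC -big_split /=; congr (_ + _).
by apply: eq_bigr => y yx; rewrite addrC; exact: IH.
Qed.

(** Dead ends weigh 0, so this counts the completions that reach a neighbour of [b]. A node weight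
    of the form [w * npaths x D] thus adds up [w] over all pairs of a completion and a step on
    it. *)
Definition npaths := usum (fun _ _ => 1) (fun _ _ => 0).

Lemma npathsE x D :
  npaths x D =
    if G x b then 1 else \sum_(y in nb x D) npaths y (rest x D).
Proof. by rewrite /npaths usumE add0r. Qed.

Lemma npaths_ge0 x D : 0 <= npaths x D.
Proof. by apply: tree_sum_ge0 => *. Qed.

Lemma npaths_child x D y :
  ~~ G x b -> y \in nb x D -> npaths y (rest x D) <= npaths x D.
Proof.
move=> xb yx; rewrite (npathsE x) (negbTE xb) (bigD1 y) //= lerDl.
by apply: sumr_ge0 => z _; exact: npaths_ge0.
Qed.

(** * Path counts compared with powers of the cube root of 3 *)

Section CubeRoot.
Variable th : R.
Hypotheses (th_gt0 : 0 < th) (th3 : th ^+ 3 = 3).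

(** 1.44 against 1.4422...; the tightest use is [d = 2] in [exp_th_gain], where [th ^+ 2] must be at
    least 2.06. *)
Lemma th_lb : 36 / 25 <= th.
Proof.
rewrite leNgt; apply/negP => lt_th.
have : th ^+ 3 < (36 / 25) ^+ 3 by rewrite ltrXn2r // ?nnegrE ?ltW //; lra.
rewrite th3; lra.
Qed.

Lemma th_ge1 : 1 <= th.
Proof. by have := th_lb; lra. Qed.

(** Equivalently, the surplus [100 * (th ^+ d - d)] is at least [d * (1 + d)]: it pays a weight
    [1 + d] for each of the at most [d * th ^+ #|rest x D|] completions at a node of degree [d]. *)
Lemma exp_th_gain d :
  d != 3%N -> d%:R * (101 + d%:R) <= 100 * th ^+ d.
Proof.
have t2 : 207 / 100 <= th ^+ 2.
  by have := th_lb; rewrite expr2; nra.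
case: d => [|[|[|[//|d]]]] _.
- by rewrite mul0r expr0; lra.
- by rewrite expr1; have := th_lb; lra.
- by lra.
elim: d => [|d IHd].
  by rewrite exprS th3; have := th_lb; lra.
rewrite exprS; have := th_lb; move: IHd; set e := th ^+ _.
rewrite -[d.+4.+1]addn1 natrD; have : 4 <= d.+4%:R :> R by rewrite ler_nat.
set m := d.+4%:R => m4 IHd tlb.
have e0 : 0 <= e by rewrite exprn_ge0 // ltW.
nra.
Qed.

Lemma exp_th_ge d : d%:R <= th ^+ d.
Proof.
have [->|d3] := eqVneq d 3; first by rewrite th3.
have := exp_th_gain d3; have : 0 <= d%:R :> R by [].
nra.
Qed.

Lemma exp_th_ge1 d : 1 <= th ^+ d.
Proof. exact/exprn_ege1/th_ge1. Qed.

Lemma exp_th_split x D : th ^+ #|D| = th ^+ #|nb x D| * th ^+ #|rest x D|.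
Proof. by rewrite -exprD -card_nb_rest. Qed.

Lemma npaths_le x D : npaths x D <= th ^+ #|D|.
Proof.
apply: (usum_potential (phi := fun _ D => th ^+ #|D|)) => {}x {}D _.
  exact: exp_th_ge1.
rewrite add0r sumr_const (exp_th_split x D) -[leLHS]mulr_natl.
by apply: ler_wpM2r (exp_th_ge _); rewrite exprn_ge0 // ltW.
Qed.

Lemma npaths_le_children x D :
  ~~ G x b -> npaths x D <= #|nb x D|%:R * th ^+ #|rest x D|.
Proof.
move=> xb; rewrite npathsE (negbTE xb) mulr_natl -sumr_const.
by apply: ler_sum => y _; exact: npaths_le.
Qed.

Lemma exp_th_linear r : r%:R + 100 <= 100 * th ^+ r.
Proof.
elim: r => [|r]; first by rewrite expr0; lra.
rewrite exprS -natr1; have := th_lb; have := exp_th_ge1 r.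
set e := th ^+ r; have : 0 <= r%:R :> R by [].
nra.
Qed.

(** The potential is 100 times the deficit [th ^+ #|D| - npaths x D]. Its total over the children
    never exceeds its value at the parent, it drops by the surplus of [exp_th_gain] at degrees other
    than 3, and [exp_th_linear] handles the leaves. *)
Lemma unbalanced_sum x D :
  usum (fun _ D => #|D|%:R)
       (fun x D => (#|nb x D| != 3%N)%:R * ((1 + #|nb x D|%:R) * npaths x D))
       x D <= 100 * (th ^+ #|D| - npaths x D).
Proof.
apply: (usum_potential (phi := fun x D => 100 * (th ^+ #|D| - npaths x D)));
  move=> {}x {}D.
  by move=> xb; rewrite npathsE xb; have := exp_th_linear #|D|; lra.
move=> xb; rewrite -mulr_sumr sumrB sumr_const.
have -> : \sum_(y in nb x D) npaths y (rest x D) = npaths x D.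
  by rewrite [RHS]npathsE (negbTE xb).
rewrite (exp_th_split x D) -[_ *+ _]mulr_natl.
have := npaths_le_children D xb; have := npaths_ge0 x D.
set d := #|nb x D|; set m := th ^+ #|rest x D|; set N := npaths x D => N0 leN.
have m0 : 0 <= m by rewrite exprn_ge0 // ltW.
have d0 : 0 <= d%:R :> R by [].
have [d3|d3] := eqVneq d 3; rewrite /= ?mul0r ?mul1r.
  by have := exp_th_ge d; nra.
have := exp_th_gain d3; nra.
Qed.

Definition fair x D :=
  [forall y in nb x D, npaths x D <= 16 * npaths y (rest x D)].

Lemma sqrt_le_mean (t u : R) : 0 <= t -> 0 <= u -> Num.sqrt (t * u) <= (t + u) / 2.
Proof.
move=> t0 u0; have m0 : 0 <= (t + u) / 2 by lra.
rewrite -[leRHS]ger0_norm // -sqrtr_sqr; apply: ler_wsqrtr.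
by have := sqr_ge0 (t - u); rewrite !expr2; lra.
Qed.

(** A share of at most 1/16 is far enough from 1/3 for the inequality of geometric and arithmetic
    means to leave a gap of 1/20; hence the 16 in [fair]. *)
Lemma sqrt_le_mean_gap (t : R) :
  0 <= t -> 16 * t <= 1 -> Num.sqrt (t * (1 / 3)) <= (t + 1 / 3) / 2 - 1 / 20.
Proof.
move=> t0 t1; have m0 : 0 <= (t + 1 / 3) / 2 - 1 / 20 by lra.
rewrite -[leRHS]ger0_norm // -sqrtr_sqr; apply: ler_wsqrtr.
by rewrite expr2; nra.
Qed.

(* By concavity sqrt (npaths * theta^|D|) does not increase on average along the
   tree, and at an unfair node it drops by a constant factor. *)
Lemma unfair_sum x D :
  usum (fun _ _ => 0)
       (fun x D => ((#|nb x D| == 3%N) && ~~ fair x D)%:R * npaths x D) x D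
  <= 20 * Num.sqrt (npaths x D * th ^+ #|D|).
Proof.
apply: (usum_potential
  (phi := fun x D => 20 * Num.sqrt (npaths x D * th ^+ #|D|)));
  move=> {}x {}D xb; first by rewrite mulr_ge0 ?sqrtr_ge0.
rewrite -mulr_sumr.
have [N0|Npos] := leP (npaths x D) 0.
  have Nx : npaths x D = 0 by apply: le_anti; rewrite N0 npaths_ge0.
  rewrite Nx mulr0 add0r mul0r sqrtr0 mulr0 big1 ?mulr0 // => y yx.
  have -> : npaths y (rest x D) = 0.
    by apply: le_anti; rewrite npaths_ge0 andbT -Nx npaths_child.
  by rewrite mul0r sqrtr0.
set N := npaths x D in Npos *; set M := th ^+ #|D|.
set d := #|nb x D|; set m := th ^+ #|rest x D|.
have Mpos : 0 < M by rewrite exprn_gt0.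
have mpos : 0 < m by rewrite exprn_gt0.
have MdE : M = th ^+ d * m by exact: exp_th_split.
have Nsum : \sum_(y in nb x D) npaths y (rest x D) / N = 1.
  have NE : \sum_(y in nb x D) npaths y (rest x D) = N.
    by rewrite /N [RHS]npathsE (negbTE xb).
  by rewrite -mulr_suml NE divff // gt_eqF.
pose S := Num.sqrt (N * M).
have S0 : 0 <= S by exact: sqrtr_ge0.
have SN : N <= S.
  rewrite -[N]ger0_norm ?(ltW Npos) // -sqrtr_sqr expr2; apply: ler_wsqrtr.
  by rewrite ler_wpM2l ?(ltW Npos) // npaths_le.
(* Relative to the parent, the potential of [y] is the geometric mean of its share of the
   completions and of [m / M]. The shares sum to 1 and [d * (m / M)] is at most 1, so the arithmetic
   means sum to at most 1. *)
have SE y : Num.sqrt (npaths y (rest x D) * m) =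
    S * Num.sqrt ((npaths y (rest x D) / N) * (m / M)).
  rewrite -sqrtrM ?mulr_ge0 ?ltW //; congr Num.sqrt; field.
  by rewrite !gt_eqF.
under eq_bigr do rewrite SE.
rewrite -mulr_sumr -/S.
have t0 y : 0 <= npaths y (rest x D) / N.
  by rewrite divr_ge0 ?npaths_ge0 // ltW.
have u0 : 0 <= m / M by rewrite divr_ge0 ?ltW.
have le1 y : Num.sqrt (npaths y (rest x D) / N * (m / M)) <=
   (npaths y (rest x D) / N + m / M) / 2 by exact: sqrt_le_mean.
have meanE : \sum_(y in nb x D) (npaths y (rest x D) / N + m / M) / 2 =
    (1 + d%:R * (m / M)) / 2.
  by rewrite -mulr_suml big_split /= Nsum sumr_const mulr_natl.
have du : d%:R * (m / M) <= 1.
  rewrite mulrA ler_pdivrMr // mul1r MdE.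
  by apply: ler_wpM2r (exp_th_ge _); exact: ltW.
case: (boolP (_ && _)) => [/andP[/eqP d3 /forall_inPn[y yx unf]]|_]; last first.
  have : \sum_(y in nb x D) Num.sqrt (npaths y (rest x D) / N * (m / M)) <= 1.
    by apply: le_trans (ler_sum _ (fun y _ => le1 y)) _; rewrite meanE; lra.
  by rewrite mul0r; nra.
have u3 : m / M = 1 / 3.
  by rewrite MdE d3 th3; field; rewrite gt_eqF.
(* A drop by [S / 20], times the factor 20 of the potential, pays for [N <= S]. *)
suff : \sum_(y in nb x D) Num.sqrt (npaths y (rest x D) / N * (m / M)) <= 19 / 20.
  by rewrite mul1r; nra.
have -> : 19 / 20 = (1 + d%:R * (m / M)) / 2 - 1 / 20 by rewrite u3 d3; lra.
rewrite -meanE !(bigD1 y yx) /= addrAC; apply: lerD; last exact: ler_sum.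
rewrite u3; apply: sqrt_le_mean_gap => //.
by rewrite mulrA ler_pdivrMr // mul1r; rewrite -ltNge in unf; exact: ltW.
Qed.

(** * Regular steps and the total charge of irregular ones *)

Definition regular x D :=
  [&& #|nb x D| == 3%N, fair x D
    & [forall y in nb x D, ~~ G y b && (#|nb y (rest x D)| == 3%N)]].

Lemma regularP x D : regular x D ->
  #|nb x D| = 3%N /\ forall y, y \in nb x D ->
    [/\ ~~ G y b, #|nb y (rest x D)| = 3%N
      & npaths x D <= 16 * npaths y (rest x D)].
Proof.
case/and3P=> /eqP d3 /forall_inP fairx /forall_inP ch3; split=> // y yx.
by have /andP[? /eqP ?] := ch3 y yx; split=> //; exact: fairx.
Qed.

(** The vertices left at the end of a path will be exceptional, hence the leaf weight. An irregular
    step is weighted by the number of vertices it deletes, since each of them can hit several blocks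
    at once. *)
Definition charge :=
  usum (fun _ D => #|D|%:R)
       (fun x D => (~~ regular x D)%:R * (#|nb x D|%:R * npaths x D)).

Lemma npaths_dead x D : ~~ G x b -> #|nb x D| = 0%N -> npaths x D = 0.
Proof.
move=> xb /cards0_eq d0; rewrite npathsE (negbTE xb) d0; exact: big_set0.
Qed.

Lemma npaths_le_degree x D :
  ~~ G x b -> npaths x D <= #|nb x D|%:R * npaths x D.
Proof.
move=> xb; have [d0|d0] := posnP #|nb x D|.
  by rewrite (npaths_dead xb d0) mulr0.
by rewrite ler_peMl ?npaths_ge0 // ler1n.
Qed.

Lemma charge_le x D : charge x D <= 5000 * th ^+ #|D|.
Proof.
pose g x D := if G x b then 1 else (#|nb x D| != 3%N)%:R * npaths x D.
pose nd1 x D := (#|nb x D| != 3%N)%:R * ((1 + #|nb x D|%:R) * npaths x D).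
pose nd2 x D := ((#|nb x D| == 3%N) && ~~ fair x D)%:R * npaths x D.
pose nd3 x D := \sum_(y in nb x D) g y (rest x D).
have g0 y E : 0 <= g y E by rewrite /g; case: ifP => // _; rewrite mulr_ge0 ?npaths_ge0.
(* An irregular step has degree other than 3 ([nd1]), or degree 3 and is unfair ([nd2], weight 3),
   or is fair with a bad child ([nd3]). In the last case that child carries at least 1/16 of the
   completions, hence 48 = 3 * 16. *)
have le1 : charge x D <=
    usum (fun _ D => #|D|%:R + (3 * 0 + 48 * 0))
         (fun x D => nd1 x D + (3 * nd2 x D + 48 * nd3 x D)) x D.
  apply: tree_sum_le => {}x {}D xb; first by lra.
  have N0 := npaths_ge0 x D.
  have nd30 : 0 <= nd3 x D by apply: sumr_ge0 => *; exact: g0.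
  rewrite /nd1 /nd2 /regular; have [d3|d3] := eqVneq #|nb x D| 3%N; last first.
    by rewrite /= !mul1r mul0r; nra.
  have [fx|fx] := boolP (fair x D); last by rewrite /= d3 !mul1r mul0r; nra.
  case: forall_inP => [_|/forall_inP/forall_inPn[y yx bad]] /=.
    by rewrite !mul0r; lra.
  have yx3 : g y (rest x D) <= nd3 x D.
    by rewrite /nd3 (bigD1 y) //= lerDl; apply: sumr_ge0 => *; exact: g0.
  have := forall_inP fx y yx; rewrite d3 !mul0r mul1r.
  suff <- : g y (rest x D) = npaths y (rest x D) by nra.
  rewrite /g; move: bad; rewrite negb_and negbK npathsE.
  by case: ifP => // -> /= ->; rewrite mul1r.
apply: le_trans le1 _; rewrite !tree_sumD !tree_sumZ.
have P1 : usum (fun _ D => #|D|%:R) nd1 x D <=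
    100 * (th ^+ #|D| - npaths x D) by exact: unbalanced_sum.
have P2 : usum (fun _ _ => 0) nd2 x D <=
    20 * Num.sqrt (npaths x D * th ^+ #|D|) by exact: unfair_sum.
have P3 : usum (fun _ _ => 0) nd3 x D <= usum g g x D.
  by rewrite -usum_children lerDl.
have P4 : usum g g x D <= usum (fun _ D => 1 + #|D|%:R) (fun x D => 0 + nd1 x D) x D.
  apply: tree_sum_le => z E xb; rewrite /g; first by rewrite xb lerDl.
  rewrite (negbTE xb) add0r /nd1 ler_wpM2l // ler_peMl ?npaths_ge0 //.
  by rewrite lerDl.
rewrite tree_sumD in P4.
have P5 : Num.sqrt (npaths x D * th ^+ #|D|) <= th ^+ #|D|.
  have M0 : 0 <= th ^+ #|D| by rewrite exprn_ge0 // ltW.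
  rewrite -[leRHS]ger0_norm // -sqrtr_sqr expr2; apply: ler_wsqrtr.
  by rewrite ler_wpM2r // npaths_le.
(* With [M = th ^+ #|D|] and [N = npaths x D] the total is at most [100 * (M - N) + 60 * M + 48 * (N
   + 100 * (M - N))], hence at most [4960 * M]. *)
have N0 := npaths_ge0 x D; have NM := npaths_le x D.
rewrite -/(npaths x D) in P4.
move: P1 P2 P3 P4 P5.
set u1 := usum _ nd1 x D; set u2 := usum _ nd2 x D; set u3 := usum _ nd3 x D.
set u4 := usum g g x D; set S := Num.sqrt _; set M := th ^+ _ in NM *.
lra.
Qed.

(* Number of pairs (path avoiding T, irregular step of it that deletes part of
   T), plus the number of paths that end without having deleted all of T. *)
Definition residue T :=
  tree_sum T (fun _ D => (T :&: D != set0)%:R)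
         (fun x D => ((T :&: nb x D != set0) && ~~ regular x D)%:R * npaths x D).

Lemma residue_ge0 T x D : 0 <= residue T x D.
Proof. by apply: tree_sum_ge0 => *; rewrite ?mulr_ge0 ?npaths_ge0. Qed.

Lemma residue_child T x D y : ~~ G x b -> y \in nb x D -> y \notin T ->
  residue T y (rest x D) <= residue T x D.
Proof.
move=> xb yx yT; rewrite [leRHS]/residue tree_sumE (negbTE xb) -/(residue T) (bigD1 y) ?yx //=.
rewrite addrCA lerDl addr_ge0 ?mulr_ge0 ?npaths_ge0 //.
by apply: sumr_ge0 => *; exact: residue_ge0.
Qed.

(* A regular step from x cannot delete all that is left of T: the neighbours of a
   vertex v of T in D1 would then include its 3 later neighbours, those in T, and
   x. So T can be avoided at each regular step hitting it, and fairness bounds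
   the loss. *)
Lemma residue_lower_bound T D1 :
  (#|T| <= 3)%N -> T \subset D1 ->
  (forall v, v \in T -> #|nb v D1| = 3 + #|nb v T|)%N ->
  forall x D, D \subset D1 -> x \in D1 -> x \notin D -> x \notin T ->
    T :&: D != set0 ->
    npaths x D <= 16 ^+ #|T :&: D|.-1 * residue T x D.
Proof.
move=> T3 TD1 degT; apply: tree_ind => x D IH DD1 xD1 xD xT TD.
have pow1 : 1 <= 16 ^+ #|T :&: D|.-1 :> R by rewrite exprn_ege1 // ler1n.
have r0 := residue_ge0 T x D.
have [xb|xb] := boolP (G x b).
  by rewrite npathsE xb /residue tree_sumE xb TD mulr1.
have [touch|untouch] := boolP (T :&: nb x D != set0); last first.
  have nTx y : y \in nb x D -> y \notin T.
    move=> yx; apply: contraNN untouch => yT.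
    by apply/set0Pn; exists y; rewrite inE yT.
  have TDE : T :&: rest x D = T :&: D.
    apply/setP=> v; rewrite !in_setI in_rest; case: (boolP (v \in T)) => //= vT.
    apply: andb_idl => vD; have := nTx v; rewrite in_nb vD andbT vT.
    by case: (G x v) => // /(_ isT).
  rewrite npathsE /residue tree_sumE -/(residue T) (negbTE xb) (negbTE untouch) mul0r add0r.
  have -> : \sum_(y in nb x D | y \notin T) residue T y (rest x D) =
      \sum_(y in nb x D) residue T y (rest x D).
    by apply: eq_bigl => y; apply: andb_idr => /nTx.
  rewrite mulr_sumr; apply: ler_sum => y yx.
  have /[!in_nb]/andP[_ yD] := yx.
  rewrite -TDE; apply: IH => //.
  - exact: subset_trans (rest_sub _ _) DD1.
  - exact: subsetP DD1 _ yD.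
  - by rewrite in_rest; move: yx; rewrite in_nb => /andP[->].
  - exact: nTx.
  - by rewrite TDE.
have [okx|bad] := boolP (regular x D); last first.
  suff : npaths x D <= residue T x D by have := npaths_ge0 x D; nra.
  rewrite /residue tree_sumE -/(residue T) (negbTE xb) touch bad mul1r lerDl.
  by apply: sumr_ge0 => *; exact: residue_ge0.
have [d3 chx] := regularP okx.
have TDrest : T :&: rest x D != set0.
  apply: contraTneq touch => T0; rewrite negbK.
  apply: contraT => /set0Pn[v /setIP[vT vx]].
  have [_ v3 _] := chx v vx.
  have vxG : G v x by move: vx; rewrite in_nb adjacent_sym => /andP[].
  have : (#|nb v (rest x D) :|: (nb v T :|: [set x])| <= #|nb v D1|)%N.
    apply: subset_leq_card; apply/subsetP=> w; rewrite !inE.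
    case/orP=> [/andP[-> /andP[_ /(subsetP DD1)]]|] //.
    case/orP=> [/andP[-> /(subsetP TD1)]|/eqP->] //.
    by rewrite vxG.
  rewrite degT // !cardsU v3 cards1.
  have -> : nb v T :&: [set x] = set0.
    apply/setP=> w; rewrite !inE; apply/negP=> /andP[/andP[_ wT] /eqP wx].
    by rewrite -wx wT in xT.
  have -> : nb v (rest x D) :&: (nb v T :|: [set x]) = set0.
    apply/setP=> w; rewrite in_setI in_nb in_setU in_set1 in_set0.
    apply/negP=> /andP[/andP[_ wr]] /orP[/[!in_nb]/andP[_ wT]|/eqP wx].
      by have := in_set0 w; rewrite -T0 inE wT wr.
    by move: wr; rewrite in_rest wx (negbTE xD) andbF.
  by rewrite !cards0 !subn0 addnA addn1 ltnn.
have split_card : (#|T :&: D| = #|T :&: nb x D| + #|T :&: rest x D|)%N.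
  by rewrite /nb /rest (setIC (nbh G x)) setIA setIDA cardsID.
have touch1 : (0 < #|T :&: nb x D|)%N by rewrite card_gt0.
have rest1 : (0 < #|T :&: rest x D|)%N by rewrite card_gt0.
have leT : (#|T :&: D| <= 3)%N by apply: leq_trans T3; exact/subset_leq_card/subsetIl.
(* As part of [T] survives the step, at most two of the three children lie in [T]. Descending to
   another one costs a factor 16 while [T :&: D] loses a vertex, which accounts for the exponent. *)
have /set0Pn[y /setDP[yx yT]] : nb x D :\: T != set0.
  by rewrite -card_gt0 cardsD d3 setIC subn_gt0 (leq_trans _ leT) // split_card
    -addn1 leq_add2l.
have [_ _ fairy] := chx y yx.
have /[!in_nb]/andP[xGy yD] := yx.
have IHy : npaths y (rest x D) <=
    16 ^+ #|T :&: rest x D|.-1 * residue T y (rest x D).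
  apply: IH => //.
  - exact: subset_trans (rest_sub _ _) DD1.
  - exact: subsetP DD1 _ yD.
  - by rewrite in_rest xGy.
have ry := residue_child xb yx yT; have ry0 := residue_ge0 T y (rest x D).
have powle : 16 * 16 ^+ #|T :&: rest x D|.-1 <= 16 ^+ #|T :&: D|.-1 :> R.
  rewrite -exprS prednK // ler_weXn2l ?ler1n //.
  by rewrite split_card -(prednK touch1) addSn /= leq_addl.
apply: (le_trans fairy); apply: le_trans (ler_wpM2l (ler0n _ _) IHy) _.
rewrite mulrA; apply: le_trans (ler_wpM2r ry0 powle) _.
by apply: ler_wpM2l ry; apply: le_trans pow1.
Qed.

(** * Conflicts between children, charged to irregular steps *)

Definition multiplicity Ts v := count (fun T : {set V} => v \in T) Ts.

Lemma touch_count Ts D :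
  \sum_(T <- Ts) (T :&: D != set0)%:R <= (\sum_(v in D) multiplicity Ts v)%:R :> R.
Proof.
elim: Ts => [|T Ts IH]; first by rewrite big_nil.
rewrite big_cons /multiplicity /= big_split natrD; apply: lerD IH.
rewrite ler_nat; case: set0Pn => //= -[v /setIP[vT vD]].
by rewrite (bigD1 v) //= vT.
Qed.

(* Each new block containing v also deletes a neighbour of v, so the sum below
   does not grow. *)
Definition bounded_multiplicity Ts D :=
  forall v, v \in D -> (0 < multiplicity Ts v -> multiplicity Ts v + #|nb v D| <= 6)%N.

Lemma touch_bound Ts D E : bounded_multiplicity Ts D -> E \subset D ->
  \sum_(T <- Ts) (T :&: E != set0)%:R <= 6 * #|E|%:R :> R.
Proof.
move=> multT ED; apply: le_trans (touch_count _ _) _.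
rewrite -natrM ler_nat mulnC -sum_nat_const; apply: leq_sum => v vE.
have [->//|m0] := posnP (multiplicity Ts v).
by apply: leq_trans (multT v (subsetP ED v vE) m0); exact: leq_addr.
Qed.

(** The pair is ordered: the block is what is available after [p.1], and the paths through [p.2] pay
    for it. One pair per node is enough. *)
Definition conflict x D : option (V * V) :=
  if regular x D then
    [pick p : V * V | [&& p.1 \in nb x D, p.2 \in nb x D, regular p.1 (rest x D),
       regular p.2 (rest x D) & nb p.1 (rest x D) != nb p.2 (rest x D)]]
  else None.

Definition conflict_block x D (p : V * V) := nb p.1 (rest x D).

Definition conflict_residue x D :=
  if conflict x D is Some p then residue (conflict_block x D p) p.2 (rest x D) else 0.

Lemma conflict_residue_ge0 x D : 0 <= conflict_residue x D.
Proof. by rewrite /conflict_residue; case: conflict => // p; exact: residue_ge0. Qed.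

Lemma conflictP x D p : conflict x D = Some p ->
  [/\ regular x D, p.1 \in nb x D /\ p.2 \in nb x D, regular p.1 (rest x D),
     regular p.2 (rest x D) & nb p.1 (rest x D) != nb p.2 (rest x D)].
Proof.
rewrite /conflict; case: ifP => // okx; case: pickP => // q /and5P[q1 q2 ok1 ok2 neq].
by case=> <-.
Qed.

Lemma nb_sub x D D' : D \subset D' -> nb x D \subset nb x D'.
Proof. exact: setIS. Qed.

(** As [p.1] is regular, its child [v] keeps exactly 3 neighbours once the block is deleted; its
    other neighbours lie in the block. This is the degree hypothesis of [residue_lower_bound]. *)
Lemma block_degree x D p v : conflict x D = Some p -> v \in conflict_block x D p ->
  #|nb v (rest x D)| = (3 + #|nb v (conflict_block x D p)|)%N.
Proof.
case/conflictP=> okx _ /regularP[_ ok1] _ _ vp; have [_ <- _] := ok1 v vp.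
rewrite -(cardsID (nbh G p.1)) addnC /nb /conflict_block /nb /rest.
by rewrite -setIDA -setIA [in X in (_ + X)%N](setIC (_ :\: _)).
Qed.

Lemma block_inner x D p v : conflict x D = Some p -> v \in conflict_block x D p ->
  (#|nb v (conflict_block x D p)| <= 2)%N.
Proof.
case/conflictP=> okx [p1x _] _ _ _ vp.
have [_ ch] := regularP okx; have [_ p13 _] := ch _ p1x.
rewrite -ltnS -p13 [ltnRHS](cardsD1 v) vp add1n ltnS.
apply: subset_leq_card; apply/subsetP=> w; rewrite in_nb in_setD1.
case/andP=> vw ->; rewrite andbT; apply: contraTneq vw => ->.
by rewrite adjacent_irrefl.
Qed.

(** The blocks being avoided on the way to [y]: those containing [y] are dropped because their
    residue skips [y], and a new one opens only on passing to [p.2]. *)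
Definition next_blocks Ts x D y :=
  [seq T : {set V} <- Ts | y \notin T] ++
  (if conflict x D is Some p then
     if y == p.2 then [:: conflict_block x D p] else [::] else [::]).

Lemma bounded_multiplicity_next Ts x D y :
  bounded_multiplicity Ts D -> y \in nb x D ->
  bounded_multiplicity (next_blocks Ts x D y) (rest x D).
Proof.
move=> multT yx v vr; have /[!in_rest]/andP[xv vD] := vr.
have le_nb : (#|nb v (rest x D)| <= #|nb v D|)%N.
  exact/subset_leq_card/nb_sub/rest_sub.
have le_mult : (multiplicity [seq T : {set V} <- Ts | y \notin T] v <= multiplicity Ts v)%N.
  by rewrite /multiplicity count_filter; apply: sub_count => T /= /andP[].
rewrite /multiplicity /next_blocks count_cat -/(multiplicity _ v).
have drop n : (n <= multiplicity Ts v -> 0 < n -> n + #|nb v (rest x D)| <= 6)%N.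
  move=> le_n n0; have := multT v vD (leq_trans n0 le_n).
  by apply: leq_trans; exact: leq_add.
case confE: (conflict x D) => [p|]; last by rewrite /= addn0; exact: drop.
case: eqP => _; last by rewrite /= addn0; exact: drop.
rewrite /= addn0; case: (boolP (v \in _)) => vp; last by rewrite addn0; exact: drop.
(* If [v] was in no block, then multiplicity 1, the 3 later neighbours and at most 2 neighbours
   inside the block make up the 6. Otherwise the deleted neighbour [p.1] compensates for the new
   block. *)
move=> _; have [m0|m0] := posnP (multiplicity Ts v).
  have -> : multiplicity [seq T : {set V} <- Ts | y \notin T] v = 0%N.
    by apply/eqP; rewrite -leqn0 -m0.
  rewrite (block_degree confE vp).
  by have := block_inner confE vp; rewrite add0n add1n !ltnS.
have lt_nb : (#|nb v (rest x D)| < #|nb v D|)%N.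
  have [_ [p1x _] _ _ _] := conflictP confE.
  apply: proper_card; apply/properP; split; first exact/nb_sub/rest_sub.
  exists p.1; last by rewrite in_nb in_rest; move: p1x; rewrite in_nb => /andP[->]; rewrite andbF.
  move: vp p1x; rewrite !in_nb adjacent_sym => /andP[-> _] /andP[_ ->] //.
apply: leq_trans (multT v vD m0); rewrite addn1 addSn -addnS.
exact: leq_add.
Qed.

Lemma sum_next_blocks Ts x D :
  \sum_(y in nb x D) \sum_(T <- next_blocks Ts x D y) residue T y (rest x D) =
  \sum_(T <- Ts) \sum_(y in nb x D | y \notin T) residue T y (rest x D) +
    conflict_residue x D.
Proof.
under eq_bigr => y _ do rewrite big_cat big_filter.
rewrite big_split /=; congr (_ + _).
  by rewrite (exchange_big_dep xpredT).
rewrite /conflict_residue; case confE: (conflict x D) => [p|]; last first.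
  by rewrite big1 // => y _; rewrite big_nil.
have [_ [_ p2x] _ _ _] := conflictP confE.
rewrite (bigD1 p.2) //= eqxx big_seq1 big1 ?addr0 // => y /andP[_ /negbTE->].
by rewrite big_nil.
Qed.

(** The induction carries the list of open blocks. Each irregular step pays for the open blocks it
    touches, at most 6 per deleted vertex, and so does each vertex left at a leaf; a conflict only
    adds a block to the list. *)
Lemma residue_sum_le x D Ts : bounded_multiplicity Ts D ->
  \sum_(T <- Ts) residue T x D + usum (fun _ _ => 0) conflict_residue x D <= 6 * charge x D.
Proof.
move: x D Ts; apply: tree_ind => x D IH Ts multT.
rewrite usumE /charge usumE -/charge.
have residueE T : residue T x D = if G x b then (T :&: D != set0)%:R else
    (T :&: nb x D != set0)%:R * ((~~ regular x D)%:R * npaths x D) +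
    \sum_(y in nb x D | y \notin T) residue T y (rest x D).
  rewrite {1}/residue tree_sumE -/(residue T); case: ifP => // _.
  by rewrite mulrA -natrM mulnb.
under eq_bigr => T _ do rewrite residueE.
case: ifPn => xb; first by rewrite addr0 (touch_bound multT).
rewrite big_split -mulr_suml /=.
have le1 : (\sum_(T <- Ts) (T :&: nb x D != set0)%:R) *
     ((~~ regular x D)%:R * npaths x D) <=
    6 * ((~~ regular x D)%:R * (#|nb x D|%:R * npaths x D)).
  rewrite mulrCA [leRHS]mulrCA; apply: ler_wpM2l => //.
  rewrite mulrA; apply: ler_wpM2r; first exact: npaths_ge0.
  by rewrite (touch_bound multT) // subsetIr.
have le2 : \sum_(T <- Ts) \sum_(y in nb x D | y \notin T) residue T y (rest x D) +
    conflict_residue x D + \sum_(y in nb x D) usum (fun _ _ => 0) conflict_residue y (rest x D) <=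
    6 * \sum_(y in nb x D) charge y (rest x D).
  rewrite -sum_next_blocks -big_split mulr_sumr; apply: ler_sum => y yx.
  by apply: IH => //; exact: bounded_multiplicity_next.
by have := lerD le1 le2; rewrite mulrDr !addrA.
Qed.

(** * Good steps and the total cost of the others *)

Definition good x D :=
  regular x D && [forall y in nb x D, forall z in nb x D,
               nb y (rest x D) == nb z (rest x D)].

Lemma goodP x D : good x D ->
  #|nb x D| = 3%N /\
  forall y z, y \in nb x D -> z \in nb x D -> nb y (rest x D) = nb z (rest x D).
Proof.
case/andP=> /regularP[d3 _] /forall_inP eqnb; split=> // y z yx zx.
exact/eqP/(forall_inP (eqnb y yx)).
Qed.

(** A step that is not good will make exceptional the vertices it deletes and the cluster after it,
    which has at most 3 vertices. *)
Definition cost :=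
  usum (fun _ D => #|D|%:R)
       (fun x D => (~~ good x D)%:R * ((#|nb x D| + 3)%:R * npaths x D)).

(** Two children with different neighbourhoods are available. Either one of them is irregular and
    carries at least 1/16 of the completions, or there is a conflict, which [residue_lower_bound]
    turns into residue. *)
Lemma npaths_defect x D : ~~ G x b -> regular x D -> ~~ good x D ->
  npaths x D <=
    16 * (\sum_(y in nb x D) (~~ regular y (rest x D))%:R * npaths y (rest x D)) +
    16 ^+ 4 * conflict_residue x D.
Proof.
move=> xb okx; rewrite /good okx => /forall_inPn[y yx /forall_inPn[z zx nyz]].
have [d3 ch] := regularP okx.
have tr0 : 0 <= 16 ^+ 4 * conflict_residue x D by rewrite mulr_ge0 ?conflict_residue_ge0 ?exprn_ge0.
have bad_child w : w \in nb x D -> ~~ regular w (rest x D) -> npaths x D <=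
    16 * (\sum_(y in nb x D) (~~ regular y (rest x D))%:R * npaths y (rest x D)) +
    16 ^+ 4 * conflict_residue x D.
  move=> wx badw; have [_ _ fw] := ch w wx.
  apply: le_trans fw _; rewrite -[leLHS]addr0; apply: lerD => //.
  apply: ler_wpM2l => //; rewrite (bigD1 w) //= badw mul1r lerDl.
  by apply: sumr_ge0 => *; rewrite mulr_ge0 ?npaths_ge0.
have [oky|] := boolP (regular y (rest x D)); last exact: bad_child.
have [okz|] := boolP (regular z (rest x D)); last exact: bad_child.
have [p confE] : exists p, conflict x D = Some p.
  rewrite /conflict okx; case: pickP => [p _|/(_ (y, z))]; first by exists p.
  by rewrite /= yx zx oky okz nyz.
have [_ [p1x p2x] ok1 ok2 neq] := conflictP confE.
apply: le_trans (_ : 16 ^+ 4 * conflict_residue x D <= _); last first.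
  rewrite lerDr mulr_ge0 //.
  by apply: sumr_ge0 => *; rewrite mulr_ge0 ?npaths_ge0.
rewrite /conflict_residue confE; set D1 := rest x D in neq ok1 ok2 *; set T := conflict_block x D p.
have [_ T3 _] := ch _ p1x; have [p2b A3 fair2] := ch _ p2x.
rewrite -/(conflict_block x D p) -/T in T3 neq.
rewrite -/D1 in A3 fair2.
have /subsetPn[u uT uA] : ~~ (T \subset nb p.2 D1).
  by apply: contraNN neq => sub; rewrite eqEcard sub T3 A3.
have /subsetPn[w wA wT] : ~~ (nb p.2 D1 \subset T).
  by apply: contraNN neq => sub; rewrite eq_sym eqEcard sub T3 A3.
have [_ ch2] := regularP ok2; have [_ _ fairw] := ch2 w wA.
have TD1 : T \subset D1 by exact: subsetIr.
have /[!in_nb]/andP[p2w wD1] := wA.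
(* Two fair steps, to [p.2] and to [w] outside [T], cost 16 each; avoiding what is left of [T] costs
   at most [16 ^+ 2]. The vertex [u] ensures that something is left. *)
have lb : npaths w (rest p.2 D1) <=
    16 ^+ #|T :&: rest p.2 D1|.-1 * residue T w (rest p.2 D1).
  apply: (@residue_lower_bound T D1) => //.
  - by rewrite T3.
  - by move=> v; exact: block_degree.
  - exact: rest_sub.
  - by rewrite in_rest p2w.
  apply/set0Pn; exists u; rewrite inE uT in_rest (subsetP TD1) // andbT.
  by move: uA; rewrite in_nb (subsetP TD1) // andbT.
have rw := residue_child p2b wA wT; have rw0 := residue_ge0 T w (rest p.2 D1).
have cardT : (#|T :&: rest p.2 D1|.-1 <= 2)%N.
  have : (#|T :&: rest p.2 D1| <= 3)%N by rewrite -T3 subset_leq_card ?subsetIl.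
  by case: #|_|.
have powle : 16 ^+ #|T :&: rest p.2 D1|.-1 <= 16 ^+ 2 :> R.
  by rewrite ler_weXn2l ?ler1n.
apply: le_trans fair2 _; rewrite exprS -mulrA; apply: ler_wpM2l => //.
apply: le_trans fairw _; rewrite exprS -mulrA; apply: ler_wpM2l => //.
apply: le_trans lb _; apply: le_trans (ler_wpM2r rw0 powle) _.
by apply: ler_wpM2l rw; rewrite exprn_ge0.
Qed.

Lemma cost_le x D :
  cost x D <= (100 + 36 * 16 ^+ 4) * 5000 * th ^+ #|D|.
Proof.
pose h x D := if G x b then 0 else (~~ regular x D)%:R * npaths x D.
pose nd1 x D := (~~ regular x D)%:R * (#|nb x D|%:R * npaths x D).
pose nd2 x D := \sum_(y in nb x D) h y (rest x D).
have h0 y E : 0 <= h y E by rewrite /h; case: ifP => // _; rewrite mulr_ge0 ?npaths_ge0.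
(* For irregular steps [(d + 3) * npaths <= 4 * d * npaths]. For regular ones [d + 3 = 6] multiplies
   the constants of [npaths_defect], giving 96 = 6 * 16 and [6 * 16 ^+ 4]. *)
have le1 : cost x D <=
    usum (fun _ D => 4 * #|D|%:R + (96 * 0 + 6 * 16 ^+ 4 * 0))
         (fun x D => 4 * nd1 x D + (96 * nd2 x D + 6 * 16 ^+ 4 * conflict_residue x D)) x D.
  apply: tree_sum_le => {}x {}D xb.
    have : 0 <= #|D|%:R :> R by [].
    lra.
  have nd20 : 0 <= nd2 x D by apply: sumr_ge0 => *; exact: h0.
  have t0 := conflict_residue_ge0 x D.
  have t1 : 0 <= 6 * 16 ^+ 4 * conflict_residue x D by rewrite mulr_ge0 // mulr_ge0 // exprn_ge0.
  rewrite /nd1; have [okx|badx] := boolP (regular x D); last first.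
    have -> : good x D = false by rewrite /good (negbTE badx).
    have := npaths_le_degree D xb; have := npaths_ge0 x D.
    rewrite natrD !mul1r; move: nd20 t1; clear; nra.
  have [gx|gx] := boolP (good x D).
    by rewrite !mul0r mulr0 add0r addr_ge0 // mulr_ge0.
  have := npaths_defect xb okx gx; have [-> ch] := regularP okx.
  have -> : \sum_(y in nb x D) (~~ regular y (rest x D))%:R * npaths y (rest x D) = nd2 x D.
    by apply: eq_bigr => y /ch[yb _ _]; rewrite /h (negbTE yb).
  rewrite mul1r mul0r mulr0 add0r -mulrA.
  by move: (16 ^+ 4 * conflict_residue x D) => z; lra.
apply: le_trans le1 _; rewrite !tree_sumD !tree_sumZ -/charge.
have P1 := charge_le x D.
have P2 : usum (fun _ _ => 0) nd2 x D <= charge x D.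
  apply: le_trans (_ : usum h h x D <= _).
    by rewrite -usum_children lerDl.
  apply: tree_sum_le => z E zb; first by rewrite /h zb.
  by rewrite /h (negbTE zb) ler_wpM2l // npaths_le_degree.
have P3 : usum (fun _ _ => 0) conflict_residue x D <= 6 * charge x D.
  by have := @residue_sum_le x D [::]; rewrite big_nil add0r; apply=> v _.
have p0 : 0 <= 16 ^+ 4 :> R by rewrite exprn_ge0.
rewrite -/(charge x D).
move: P1 P2 P3 p0; set u1 := usum _ nd2 x D; set u2 := usum _ conflict_residue x D.
set c := charge x D; set M := th ^+ _; move: (16 ^+ 4) => q; clear.
nra.
Qed.

End CubeRoot.

(** * Extracting a chain of clusters from a cheap path *)

Definition ucov (Ls : seq {set V}) := \bigcup_(A <- Ls) A.

(* Consecutive clusters of the braid; an entry set0 is a gap, to be filled with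
   three exceptional vertices. *)
Fixpoint chain (Ls : seq {set V}) : Prop :=
  if Ls is A :: Ls' then
    [/\ A = set0 \/ #|A| = 3%N, [disjoint A & ucov Ls'],
        forall y w, y \in A -> w \in ucov Ls' -> G y w = (w \in head set0 Ls')
      & chain Ls']
  else True.

Lemma ucov_cons A Ls : ucov (A :: Ls) = A :|: ucov Ls.
Proof. exact: big_cons. Qed.

Lemma cost_ge0 x D : 0 <= cost x D.
Proof. by apply: tree_sum_ge0 => *; rewrite ?mulr_ge0 ?npaths_ge0. Qed.

(** Averaging: if every child with completions exceeded the reduced ratio of cost to completions, so
    would their sum. *)
Lemma cost_descend x D C : ~~ G x b -> 0 < npaths x D ->
  cost x D <= C * npaths x D ->
  exists2 y, y \in nb x D & 0 < npaths y (rest x D) /\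
    cost y (rest x D) <=
      (C - (~~ good x D)%:R * (#|nb x D| + 3)%:R) * npaths y (rest x D).
Proof.
move=> xb Npos costC; set c := _ * (_ + 3)%:R.
have [/existsP[y /and3P[yx Ny cy]]|none] := boolP [exists y,
    [&& y \in nb x D, 0 < npaths y (rest x D) &
     cost y (rest x D) <= (C - c) * npaths y (rest x D)]].
  by exists y.
have gt_cost y : y \in nb x D -> 0 < npaths y (rest x D) ->
    (C - c) * npaths y (rest x D) < cost y (rest x D).
  move=> yx Ny; rewrite ltNge; apply: contraNN none => cy.
  by apply/existsP; exists y; rewrite yx Ny.
have NE : npaths x D = \sum_(y in nb x D) npaths y (rest x D).
  by rewrite npathsE (negbTE xb).
have [y yx Ny] : exists2 y, y \in nb x D & 0 < npaths y (rest x D).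
  apply/exists_inP; apply: contraTT Npos => /exists_inPn no.
  rewrite NE big1 ?ltxx // => y /no; rewrite -leNgt => N0.
  by apply: le_anti; rewrite N0 npaths_ge0.
suff : (C - c) * npaths x D < \sum_(y in nb x D) cost y (rest x D).
  move: costC; rewrite /cost tree_sumE (negbTE xb).
  rewrite (eq_bigl (fun y => y \in nb x D)); last by move=> z; rewrite in_set0 andbT.
  rewrite -/cost mulrA -/c mulrBl; lra.
rewrite NE mulr_sumr !(bigD1 y yx) /=; apply: ltr_leD; first exact: gt_cost.
apply: ler_sum => z /andP[zx _]; have [N0|Nz] := leP (npaths z (rest x D)) 0.
  have -> : npaths z (rest x D) = 0 by apply: le_anti; rewrite N0 npaths_ge0.
  by rewrite mulr0 cost_ge0.
exact/ltW/gt_cost.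
Qed.

(** The chain is built backwards along the path found by [cost_descend]; a good step prepends the
    set it deletes. The clause on [G x w] lets the preceding cluster be attached, and the count of
    gaps guarantees three exceptional vertices for each. *)
Lemma chain_exists x D C : 0 < npaths x D -> cost x D <= C * npaths x D ->
  exists Ls, [/\ chain Ls, ucov Ls \subset D,
    forall w, w \in ucov Ls -> G x w = (w \in head set0 Ls),
    (3 * count_mem set0 Ls <= #|D :\: ucov Ls|)%N
    & #|D :\: ucov Ls|%:R <= C].
Proof.
move: x D C; apply: tree_ind => x D IH C Npos costC.
have [xb|xb] := boolP (G x b).
  exists [::]; rewrite /ucov big_nil; split=> //; rewrite ?sub0set ?setD0 //.
  - by move=> w; rewrite inE.
  by move: costC; rewrite npathsE /cost tree_sumE xb mulr1.
have [y yx [Ny costy]] := cost_descend xb Npos costC.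
have [Ls [chLs covLs nbLs holes leC]] := IH y yx _ Ny costy.
have notG w : w \in rest x D -> G x w = false.
  by rewrite in_rest => /andP[/negbTE].
have [gx|gx] := boolP (good x D).
  have [d3 eqnb] := goodP gx.
  exists (nb x D :: Ls); rewrite ucov_cons.
  have DE : D :\: (nb x D :|: ucov Ls) = rest x D :\: ucov Ls.
    by rewrite -setDDl /nb /rest setDIr setDv setU0.
  rewrite DE; split=> //=.
  - split=> //; first by right.
      rewrite -setI_eq0; apply/eqP/setP=> w; rewrite !inE.
      apply/negP=> /andP[/andP[xw wD]] /(subsetP covLs).
      by rewrite in_rest xw.
    move=> z w zx wL; rewrite -nbLs //.
    have wr := subsetP covLs w wL.
    have := eqnb y z yx zx => /setP/(_ w); by rewrite !in_nb wr !andbT.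
  - rewrite subUset subsetIr; exact: subset_trans covLs (rest_sub _ _).
  - move=> w /setUP[wx|wL]; first by rewrite wx; move: wx; rewrite in_nb => /andP[].
    rewrite notG ?(subsetP covLs) // in_nb notG ?(subsetP covLs) //.
  - have -> : (nb x D == set0) = false.
      by rewrite -cards_eq0 d3.
    by rewrite add0n.
  by move: leC; rewrite gx mul0r subr0.
move: leC; rewrite gx mul1r => leC.
have cardD := card_nb_rest x D.
case: Ls chLs covLs nbLs holes leC => [|T Ls] /=.
  move=> _ _ _ _; rewrite /ucov big_nil setD0 => leC.
  exists [::]; rewrite /ucov big_nil; split=> //; rewrite ?sub0set ?setD0 //.
    by move=> w; rewrite inE.
  by move: leC; rewrite cardD !natrD; have : 0 <= 3%:R :> R by []; lra.
rewrite ucov_cons => -[T03 disT _ chLs] covLs _ holes leC.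
have covL : ucov Ls \subset rest x D by apply: subset_trans covLs; exact: subsetUr.
have covD : ucov Ls \subset D := subset_trans covL (rest_sub x D).
have cardU : #|T :|: ucov Ls| = (#|T| + #|ucov Ls|)%N.
  by rewrite cardsU (disjoint_setI0 disT) cards0 subn0.
have cardE : #|D :\: ucov Ls| =
    (#|nb x D| + #|T| + #|rest x D :\: (T :|: ucov Ls)|)%N.
  have := subset_leq_card covLs; rewrite (cardsDS covD) (cardsDS covLs) cardU cardD.
  by clear; lia.
(* After a bad step the next cluster [T] is replaced by a gap, not preceded by one: its three
   vertices, now exceptional, match the new gap. If [T] was a gap already, no gap is added. *)
exists (set0 :: Ls); rewrite ucov_cons set0U; split=> //=.
- split=> //; [by left | by rewrite -setI_eq0 set0I | by move=> z w; rewrite inE].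
- by move=> w wL; rewrite inE notG // (subsetP covL).
- rewrite eqxx cardE; move: holes; case: T03 => [->|T3].
    rewrite eqxx set0U cards0 addn0; clear; lia.
  have -> : (T == set0) = false by rewrite -cards_eq0 T3.
  rewrite T3; clear; lia.
rewrite cardE !natrD; have : #|T|%:R <= 3%:R :> R.
  by rewrite ler_nat; case: T03 => ->; rewrite ?cards0.
move: leC; rewrite natrD; clear; lra.
Qed.

End Exploration.

(** * Induced cycles through a vertex, and upper bounds on their number *)

Section Cycles.
Variables (R : rcfType) (V : finType) (G : sgraph V).

(** The vertex sets of the completions counted by [npaths], without the start and without [b]. *)
Inductive path_set (b : V) : V -> {set V} -> {set V} -> Prop :=
| PathEnd x D : G x b -> path_set b x D set0
| PathStep x D y S : ~~ G x b -> y \in nb G x D ->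
    path_set b y (rest G x D) S -> path_set b x D (y |: S).

Lemma path_setE b x D S : path_set b x D S ->
  if G x b then S = set0 else
  exists y S', [/\ y \in nb G x D, path_set b y (rest G x D) S' & S = y |: S'].
Proof. by case=> {}x {}D => [->|y {}S /negbTE-> yx pS] //; exists y, S. Qed.

Lemma path_set_family b x D : exists Fam : {set {set V}},
  #|Fam|%:R <= npaths R G b x D /\ forall S, path_set b x D S -> S \in Fam.
Proof.
move: x D; apply: (tree_ind (G := G)) => x D IH.
have [xb|xb] := boolP (G x b).
  exists [set set0]; rewrite cards1 npathsE xb; split=> // S.
  by move/path_setE; rewrite xb inE => ->.
have /fin_all_exists[Fam FamP] y : exists Fam : {set {set V}}, y \in nb G x D ->
    #|Fam|%:R <= npaths R G b y (rest G x D) /\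
    forall S, path_set b y (rest G x D) S -> S \in Fam.
  have [yx|] := boolP (y \in nb G x D); last by exists set0.
  by have [Fam FamP] := IH y yx; exists Fam.
exists (\bigcup_(y in nb G x D) [set y |: S | S : {set V} in Fam y]); split.
  rewrite npathsE (negbTE xb).
  apply: (@le_trans _ _ (\sum_(y in nb G x D) #|Fam y|)%:R).
    rewrite ler_nat; elim/big_rec2: _ => [|y n F yx]; first by rewrite cards0.
    move=> leF; apply: leq_trans (leq_card_setU _ _) _.
    by rewrite leq_add // leq_imset_card.
  by rewrite natr_sum; apply: ler_sum => y yx; have [] := FamP y yx.
move=> S /path_setE; rewrite (negbTE xb) => -[y [S' [yx pS' ->]]].
by apply/bigcupP; exists y => //; apply: imset_f; have [_] := FamP y yx; apply.
Qed.

Lemma cycle_enum (S : {set V}) v : induces_cycle G S -> v \in S ->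
  exists q (g : nat -> V),
  [/\ g 0%N = v, S = [set x in [seq g s | s <- iota 0 q.+3]],
    forall s, (0 < s <= q.+2)%N -> g s != v
    & forall s t, (s <= q.+2)%N -> (t <= q.+2)%N ->
      G (g s) (g t) = [|| t == s.+1, s == t.+1, (s == 0) && (t == q.+2)
                        | (t == 0) && (s == q.+2)]%N].
Proof.
case/andP=> m3 /existsP[f /and3P[/injectiveP injf /eqP fS /forallP adjf]] vS.
have [q mE] : exists q, #|S| = q.+3 by exists (#|S| - 3)%N; lia.
move: f injf fS adjf; rewrite mE => f injf fS adjf.
have [i0 _ vE] : exists2 i, i \in [set: 'I_q.+3] & v = f i.
  by apply/imsetP; rewrite fS.
exists q, (fun t => f (inord ((i0 + t) %% q.+3))).
have lt_mod t : ((i0 + t) %% q.+3 < q.+3)%N by rewrite ltn_pmod.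
split.
- by rewrite vE addn0 modn_small // inord_val.
- apply/setP=> x; rewrite inE -fS; apply/imsetP/mapP => [[i _ ->]|[t _ ->]].
    exists ((i + (q.+3 - i0)) %% q.+3)%N; first by rewrite mem_iota add0n ltn_pmod.
    congr (f _); apply: val_inj; rewrite /= inordK //.
    rewrite modnDmr addnCA subnKC ?(ltnW (ltn_ord i0)) //.
    by rewrite modnDr modn_small.
  by exists (inord ((i0 + t) %% q.+3)).
- move=> s /andP[s0 sq]; rewrite vE; apply/eqP => /injf /(congr1 val) /=.
  rewrite inordK // => E; have : (i0 + s == i0 + 0 %[mod q.+3])%N.
    by rewrite E addn0 modn_small.
  by rewrite eqn_modDl mod0n modn_small // (gtn_eqF s0).
move=> s t sq tq; have /forallP/(_ (inord ((i0 + t) %% q.+3)))/eqP-> :=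
  adjf (inord ((i0 + s) %% q.+3)).
have nextE u w : (u <= q.+2)%N -> (w <= q.+2)%N ->
    (inord ((i0 + w) %% q.+3) == ordS (inord ((i0 + u) %% q.+3)) :> 'I_q.+3) =
    (w == u.+1) || (w == 0%N) && (u == q.+2).
  move=> uq wq; rewrite -val_eqE /= !inordK // -[(_ %% _).+1]addn1 modnDml -addnA eqn_modDl.
  rewrite [(w %% _)%N]modn_small // addn1; move: uq; rewrite leq_eqVlt => /orP[/eqP->|uq].
    rewrite modnn eqxx andbT (@ltn_eqF w q.+3) //.
  rewrite modn_small; last by rewrite ltnS.
  by rewrite (ltn_eqF uq) andbF orbF.
rewrite /cycle_graph graph_ofE !nextE // -val_eqE /= !inordK // eqn_modDl !modn_small //.
clear -sq tq; apply/idP/idP; lia.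
Qed.

Lemma path_set_of_enum q (g : nat -> V) :
  (forall s t, (s <= q.+2)%N -> (t <= q.+2)%N ->
    G (g s) (g t) = [|| t == s.+1, s == t.+1, (s == 0) && (t == q.+2)
                      | (t == 0) && (s == q.+2)]%N) ->
  forall j t (D : {set V}), (t + j = q.+1)%N -> (0 < t)%N ->
  (forall s, (t < s <= q.+1)%N -> g s \in D) ->
  path_set (g q.+2) (g t) D [set x in [seq g s | s <- iota t.+1 j]].
Proof.
move=> adjg; elim=> [|j IH] t D tj t0 gD.
  have -> : [set x in [seq g s | s <- iota t.+1 0]] = set0.
    by apply/setP=> x; rewrite !inE.
  by apply: PathEnd; rewrite adjg //; clear -tj t0; lia.
rewrite /= set_cons; apply: PathStep.
- by rewrite adjg //; clear -tj t0; lia.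
- rewrite in_nb adjg; try by clear -tj t0; lia.
  by rewrite eqxx gD //; clear -tj; lia.
apply: IH => // [|s sq]; first by clear -tj; lia.
rewrite in_rest adjg; try by clear -tj sq; lia.
rewrite gD ?andbT //; clear -tj t0 sq; lia.
Qed.

(** Removing [v] leaves an induced path between two neighbours [a] and [b] of [v] whose inner
    vertices are not adjacent to [v]; for a triangle there are no inner vertices. *)
Lemma cycle_path_set (S U : {set V}) v :
  induces_cycle G S -> v \in S -> S \subset U ->
  exists a b S', [/\ a \in nb G v U, b \in nb G v U,
    path_set b a (rest G v (U :\ v)) S' & S = v |: (a |: (b |: S'))].
Proof.
move=> cycS vS SU; have [q [g [g0 SE gv adjg]]] := cycle_enum cycS vS.
have gU s : (s <= q.+2)%N -> g s \in U.
  move=> sq; apply: (subsetP SU); rewrite SE inE map_f // mem_iota; lia.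
exists (g 1%N), (g q.+2), [set x in [seq g s | s <- iota 2 q]]; split.
- by rewrite in_nb -g0 adjg // gU.
- by rewrite in_nb -g0 adjg // gU // !eqxx.
- apply: path_set_of_enum => // s /andP[s1 sq].
  rewrite in_rest in_setD1 gU ?gv ?andbT -?g0 ?adjg //; lia.
apply/setP=> x; rewrite [in LHS]SE -g0 [LHS]in_set.
have -> : iota 0 q.+3 = [:: 0, 1 & iota 2 q ++ [:: q.+2]]%N.
  have := iotaD 2 q 1; rewrite addn1 add2n => E.
  by rewrite -[iota 0 q.+3]/[:: 0, 1 & iota 2 q.+1]%N E.
rewrite /= map_cat !in_cons mem_cat !inE; do 2 congr (_ || _).
by rewrite orbC.
Qed.

Implicit Types (U : {set V}) (v : V).

Definition cycles_at U v : {set {set V}} :=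
  [set S | [&& induces_cycle G S, v \in S & S \subset U]].

Lemma cycles_at_le U v : #|cycles_at U v|%:R <=
  \sum_(a in nb G v U) \sum_(b in nb G v U) npaths R G b a (rest G v (U :\ v)).
Proof.
have /fin_all_exists[Fam FamP] : forall p : V * V, exists Fam : {set {set V}},
    #|Fam|%:R <= npaths R G p.2 p.1 (rest G v (U :\ v)) /\
    forall S, path_set p.2 p.1 (rest G v (U :\ v)) S -> S \in Fam.
  by move=> p; exact: path_set_family.
pose P := [set p : V * V | (p.1 \in nb G v U) && (p.2 \in nb G v U)].
have sub : cycles_at U v \subset
    \bigcup_(p in P) [set v |: (p.1 |: (p.2 |: S)) | S : {set V} in Fam p].
  apply/subsetP=> S; rewrite inE => /and3P[cycS vS SU].
  have [a [b [S' [aU bU pS' ->]]]] := cycle_path_set cycS vS SU.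
  apply/bigcupP; exists (a, b); first by rewrite inE aU.
  by apply: imset_f; have [_] := FamP (a, b); apply.
rewrite pair_big /=.
apply: (@le_trans _ _ (\sum_(p in P) #|Fam p|)%:R).
  rewrite ler_nat; apply: leq_trans (subset_leq_card sub) _.
  elim/big_rec2: _ => [|p n F pP]; first by rewrite cards0.
  move=> leF; apply: leq_trans (leq_card_setU _ _) _.
  by rewrite leq_add // leq_imset_card.
rewrite natr_sum [leRHS](eq_bigl (fun p => p \in P)) => [|p]; last first.
  rewrite /P in_set. exact: erefl.
by apply: ler_sum => p _; have [] := FamP p.
Qed.

Definition cycles_in U : {set {set V}} :=
  [set S | induces_cycle G S & S \subset U].

Lemma cycles_in_del U v :
  (#|cycles_in U| <= #|cycles_in (U :\ v)| + #|cycles_at U v|)%N.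
Proof.
apply: leq_trans (leq_card_setU _ _); apply: subset_leq_card.
apply/subsetP=> S; rewrite !inE => /andP[-> SU] /=.
by rewrite SU andbT subsetD1 SU; case: (v \in S); rewrite ?orbT.
Qed.

Variable th : R.
Hypotheses (th_gt0 : 0 < th) (th3 : th ^+ 3 = 3).

Lemma card_punctured_nb U v : v \in U ->
  #|U| = (#|nb G v U| + #|rest G v (U :\ v)|).+1.
Proof.
move=> vU; rewrite (cardsD1 v) vU add1n (card_nb_rest G v (U :\ v)); congr (_ + _).+1.
apply: eq_card => x; rewrite !in_nb in_setD1; case: eqP => [->|//].
by rewrite adjacent_irrefl.
Qed.

Lemma sum_pairs_le U v c :
  (forall a b, a \in nb G v U -> b \in nb G v U ->
     npaths R G b a (rest G v (U :\ v)) <= c) ->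
  #|cycles_at U v|%:R <= #|nb G v U|%:R ^+ 2 * c.
Proof.
move=> le_c; apply: le_trans (cycles_at_le _ _) _.
rewrite expr2 -mulrA !mulr_natl -sumr_const; apply: ler_sum => a aU.
by rewrite -sumr_const; apply: ler_sum => b bU; exact: le_c.
Qed.

Lemma sqr_le_exp_th d : d%:R ^+ 2 <= 4 * th ^+ d.+1.
Proof.
have d_half : (d <= 2 * uphalf d)%N by rewrite mul2n -leq_uphalf_double.
have half_d : (2 * uphalf d <= d.+1)%N by rewrite mul2n uphalf_half doubleD; lia.
have h := exp_th_ge th_gt0 th3 (uphalf d); set u := uphalf d in h d_half half_d *.
have u0 : 0 <= u%:R :> R by [].
apply: (@le_trans _ _ ((2 * u)%:R ^+ 2)).
  by rewrite lerXn2r ?nnegrE // ler_nat.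
apply: (@le_trans _ _ (4 * th ^+ (2 * u))).
  by rewrite natrM exprMn mulnC exprM -natrX ler_wpM2l // lerXn2r ?nnegrE // exprn_ge0 // ltW.
by rewrite ler_wpM2l // ler_weXn2l // (th_ge1 th_gt0 th3).
Qed.

Lemma cycles_at_bound U v : v \in U -> #|cycles_at U v|%:R <= 4 * th ^+ #|U|.
Proof.
move=> vU; have := card_punctured_nb vU; set d := #|nb _ _ _|; set r := #|rest _ _ _|.
move=> ->; apply: le_trans (sum_pairs_le (c := th ^+ r) _) _.
  by move=> a b _ _; exact: npaths_le.
rewrite -addSn exprD mulrA; apply: ler_wpM2r; first by rewrite exprn_ge0 // ltW.
exact: sqr_le_exp_th.
Qed.

(** Deleting the vertices one by one gives a geometric series; 16 closes the induction, as
    [16 + 4 * th <= 16 * th]. *)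
Lemma cycles_in_bound U : #|cycles_in U|%:R <= 16 * th ^+ #|U|.
Proof.
have [n] := ubnP #|U|; elim: n U => // n IHn U leUn.
have [U0|[v vU]] := set_0Vmem U.
  rewrite (_ : cycles_in U = set0) ?cards0 ?mulr_ge0 ?exprn_ge0 ?ltW //.
  apply/setP=> S; rewrite !inE U0 subset0; apply/negP=> /andP[/andP[S3 _] /eqP S0].
  by rewrite S0 cards0 in S3.
have cU : #|U| = #|U :\ v|.+1 by rewrite (cardsD1 v) vU.
have := cycles_in_del U v; rewrite -(ler_nat R) natrD => le1.
have := IHn (U :\ v); rewrite -ltnS -cU => /(_ leUn) le2.
have := cycles_at_bound vU => le3; apply: (le_trans le1); apply: le_trans (lerD le2 le3) _.
rewrite cU exprS; have := th_lb th_gt0 th3.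
have : 0 <= th ^+ #|U :\ v| by rewrite exprn_ge0 // ltW.
move: (th ^+ _) => e; nra.
Qed.

Lemma cycles_in_removal J (d : R) :
  (forall U v, v \in U -> (#|~: U| < J)%N -> #|cycles_at U v|%:R <= d) ->
  (J <= #|V|)%N ->
  exists2 U : {set V}, #|~: U| = J & #|cycles_in setT|%:R <= J%:R * d + #|cycles_in U|%:R.
Proof.
move=> le_d; suff : forall j, (j <= J)%N -> (j <= #|V|)%N ->
    exists2 U : {set V}, #|~: U| = j & #|cycles_in setT|%:R <= j%:R * d + #|cycles_in U|%:R.
  by move=> h ?; exact: h.
elim=> [|j IHj] jJ jV.
  by exists setT; rewrite ?setCT ?cards0 // mul0r add0r.
have [U cU le1] := IHj (ltnW jJ) (ltnW jV).
have [U0|[v vU]] := set_0Vmem U.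
  by have := cardsC U; rewrite U0 cards0 add0n -U0 cU => E; rewrite -E ltnn in jV.
exists (U :\ v).
  by rewrite setCD setUC cardsU1 inE vU cU add1n.
have := cycles_in_del U v; rewrite -(ler_nat R) natrD => le2.
have le3 := le_d U v vU; rewrite cU in le3; have {}le3 := le3 jJ.
by rewrite -natr1 mulrDl mul1r; move: le1 le2 le3; lra.
Qed.

End Cycles.

Lemma cube_root_3 (R : rcfType) : exists2 th : R, 0 < th & th ^+ 3 = 3.
Proof.
have [||th /andP[th1 _] /rootP] := @poly_ivt R ('X^3 - 3%:P) 1 3; first by lra.
  by rewrite !hornerE; apply/andP; split; rewrite ?expr1n; lra.
rewrite !hornerE => /eqP; rewrite subr_eq0 => /eqP th3.
by exists th => //; lra.
Qed.

(** * From many induced cycles to a chain covering almost all vertices *)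

Section RootStructure.
Variables (R : realType) (th : R).
Hypotheses (th_gt0 : 0 < th) (th3 : th ^+ 3 = 3).

Lemma archi_lt (x : R) : exists n : nat, x < n%:R.
Proof.
have [x0|x0] := leP 0 x; first by exists (Num.bound x); exact: archi_boundP.
by exists 0%N.
Qed.

Lemma exp_th_sqr_bounded (c : R) : 0 < c ->
  exists M : nat, forall d : nat, c * th ^+ d <= d%:R ^+ 2 -> (d <= M)%N.
Proof.
move=> c0; have [M leM] := archi_lt (256 / c + 4); exists M => d le_d.
suff : d%:R <= M%:R :> R by rewrite ler_nat.
have dE := divn_eq d 4; have rlt := ltn_pmod d (isT : 0 < 4)%N.
set m := (d %/ 4)%N in dE; set r := (d %% 4)%N in dE rlt.
have d_le : d%:R <= 4 * m%:R + 3 :> R.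
  by rewrite -natrM -natrD ler_nat {1}dE mulnC leq_add2l -ltnS.
have m4 : m%:R ^+ 4 <= th ^+ d.
  apply: (@le_trans _ _ ((th ^+ m) ^+ 4)).
    by apply: lerXn2r; rewrite ?nnegrE ?exprn_ge0 ?(ltW th_gt0) //; exact: exp_th_ge.
  by rewrite -exprM ler_weXn2l ?(th_ge1 th_gt0 th3) // dE leq_addr.
have [m0|m0] := posnP m.
  have q0 : 0 < 256 / c by rewrite divr_gt0.
  by move: d_le; rewrite m0; lra.
have m1 : 1 <= m%:R :> R by rewrite ler1n.
have d2 : d%:R ^+ 2 <= 64 * m%:R ^+ 2 :> R.
  have : 0 <= d%:R :> R by [].
  move: d_le m1; set x := d%:R; set y := m%:R; nra.
have cm : c * m%:R ^+ 2 <= 64.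
  have : c * m%:R ^+ 4 <= 64 * m%:R ^+ 2.
    by apply: le_trans d2; apply: le_trans le_d; rewrite ler_pM2l.
  rewrite -[4%N]/(2 + 2)%N exprD mulrA ler_pM2r // exprn_gt0 //; lra.
have mc : m%:R <= 64 / c.
  rewrite ler_pdivlMr // mulrC; apply: le_trans cm; rewrite ler_pM2l //.
  by rewrite expr2 ler_peMl.
have qE : 256 / c = 4 * (64 / c) by field; rewrite gt_eqF.
by move: leM; rewrite qE; lra.
Qed.

Lemma cluster_chain (c : R) : 0 < c -> exists C n0 : nat,
  forall (V : finType) (G : sgraph V), (n0 <= #|V|)%N ->
  c * th ^+ #|V| <= (num_induced_cycles G)%:R ->
  exists Ls : seq {set V},
    [/\ chain G Ls, (3 * count_mem set0 Ls + 2 <= #|~: ucov Ls|)%N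
      & (#|~: ucov Ls| <= C)%N].
Proof.
move=> c0.
have [J0 leJ0] := archi_lt (32 / c); pose J := J0.+1.
have JJ : 16 < c / 2 * th ^+ J.
  have := exp_th_ge th_gt0 th3 J; have : 32 / c < J%:R.
    by apply: lt_le_trans leJ0 _; rewrite ler_nat.
  by rewrite ltr_pdivrMr // mulrC; move: (th ^+ J) => e; nra.
pose c1 := c / 2 / J%:R.
have c1_gt0 : 0 < c1 by rewrite !divr_gt0.
have [M leM] := exp_th_sqr_bounded c1_gt0.
pose C2 : R := (100 + 36 * 16 ^+ 4) * 5000 * M%:R ^+ 2 / c1.
have [C3 leC3] := archi_lt C2.
exists (J + M + 1 + C3)%N, J => V G nJ cyc.
have [U [v [vU cU big]]] : exists (U : {set V}) v, [/\ v \in U, (#|~: U| < J)%N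
    & c1 * th ^+ #|V| < #|cycles_at G U v|%:R].
  have [/existsP[U /existsP[v /and3P[? ? ?]]]|none] := boolP [exists U : {set V}, exists v,
    [&& v \in U, (#|~: U| < J)%N & c1 * th ^+ #|V| < #|cycles_at G U v|%:R]].
    by exists U, v.
  have [||U cU] := @cycles_in_removal R V G J (c1 * th ^+ #|V|); rewrite //.
    move=> U v vU cU; rewrite leNgt; apply: contraNN none => lt_c.
    by apply/existsP; exists U; apply/existsP; exists v; rewrite vU cU.
  have -> : #|cycles_in G setT| = num_induced_cycles G.
    by apply: eq_card => S; rewrite !inE subsetT andbT.
  have := cycles_in_bound (R := R) G th_gt0 th3 U.
  have -> : th ^+ #|V| = th ^+ #|U| * th ^+ J by rewrite -exprD -cU cardsC.
  have -> : J%:R * (c1 * (th ^+ #|U| * th ^+ J)) = c / 2 * th ^+ J * th ^+ #|U|.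
    by rewrite /c1; field; rewrite pnatr_eq0.
  have : 0 < th ^+ #|U| by rewrite exprn_gt0.
  rewrite (_ : th ^+ #|V| = th ^+ #|U| * th ^+ J) in cyc; last first.
    by rewrite -exprD -cU cardsC.
  move: cyc JJ; nra.
have cardU := card_punctured_nb G vU; set D := rest G v (U :\ v) in cardU *.
have cardV : #|V| = (#|nb G v U| + #|D| + 1 + #|~: U|)%N.
  by rewrite -(cardsC U) cardU addn1.
have thV d : (d <= #|V|)%N -> th ^+ d <= th ^+ #|V|.
  by move=> ?; rewrite ler_weXn2l ?(th_ge1 th_gt0 th3).
have thV0 : 0 < c1 * th ^+ #|V| by rewrite mulr_gt0 ?exprn_gt0.
have le_d : (#|nb G v U| <= M)%N.
  apply: leM; have D0 : 0 < th ^+ #|D| by rewrite exprn_gt0.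
  rewrite -(ler_pM2r D0) -mulrA -exprD.
  apply: le_trans (sum_pairs_le (R := R) (v := v) (U := U) _); last first.
    by move=> a b _ _; exact: npaths_le.
  apply: le_trans (ltW big); rewrite ler_pM2l //; apply: thV.
  by rewrite cardV -addnA leq_addr.
have [a [b [aU bU]]] : exists a b, [/\ a \in nb G v U, b \in nb G v U
    & c1 * th ^+ #|V| / M%:R ^+ 2 < npaths R G b a D].
  have [/existsP[a /existsP[b /and3P[? ? ?]]]|none] := boolP [exists a, exists b,
    [&& a \in nb G v U, b \in nb G v U
      & c1 * th ^+ #|V| / M%:R ^+ 2 < npaths R G b a D]].
    by exists a, b.
  suff : #|cycles_at G U v|%:R <= c1 * th ^+ #|V| by rewrite leNgt big.
  apply: le_trans (sum_pairs_le (R := R) (v := v) (U := U)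
    (c := c1 * th ^+ #|V| / M%:R ^+ 2) _) _.
    move=> a b aU bU; rewrite leNgt; apply: contraNN none => lt_c.
    by apply/existsP; exists a; apply/existsP; exists b; rewrite aU bU.
  have [M0|M0] := posnP M.
    by move: le_d; rewrite M0 leqn0 => /eqP->; rewrite expr0n mul0r ltW.
  rewrite mulrCA ger_pMr // ler_pdivrMr ?exprn_gt0 ?ltr0n // mul1r.
  by apply: lerXn2r; rewrite ?nnegrE ?ler_nat.
have d_gt0 : (0 < #|nb G v U|)%N by rewrite card_gt0; apply/set0Pn; exists a.
have M0 : 0 < M%:R :> R by rewrite ltr0n (leq_trans d_gt0).
rewrite ltr_pdivrMr ?exprn_gt0 // => big_ab.
have Npos : 0 < npaths R G b a D.
  by rewrite -(pmulr_lgt0 _ (exprn_gt0 2 M0)); exact: lt_trans big_ab.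
have cost_ab : cost R G b a D <= C2 * npaths R G b a D.
  apply: le_trans (cost_le _ _ th_gt0 th3 _ _) _; set K := _ * 5000.
  have K0 : 0 < K by rewrite mulr_gt0 // ltr_wpDr // mulr_ge0 // exprn_ge0.
  have -> : C2 * npaths R G b a D = K * ((npaths R G b a D * M%:R ^+ 2) / c1).
    by rewrite /C2 -/K; field; rewrite gt_eqF.
  rewrite ler_pM2l // ler_pdivlMr // mulrC; apply: le_trans (ltW big_ab).
  by rewrite ler_pM2l // thV // max_card.
have [Ls [chLs covLs _ holes leC]] := chain_exists Npos cost_ab.
have {leC}leC : (#|D :\: ucov Ls| <= C3)%N.
  by rewrite -(ler_nat R); apply: le_trans leC (ltW leC3).
exists Ls; have cardC := cardsC (ucov Ls); rewrite (cardsDS covLs) in holes leC.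
have le_cov := subset_leq_card covLs; split=> //; move: le_cov cardV cardC holes leC d_gt0 le_d cU.
  by clear; lia.
by clear; lia.
Qed.

End RootStructure.

Section Assembly.
Local Open Scope nat_scope.
Variables (V : finType) (F : sgraph V).
Implicit Types (u w : V) (Ls : seq {set V}).

Lemma fiber_function k (i0 : 'I_k) (s : 'I_k -> nat) (W : {set V}) :
  \sum_i s i = #|W| ->
  exists phi : V -> 'I_k, forall i, #|[set u in W | phi u == i]| = s i.
Proof.
move: {2}#|W| (erefl #|W|) => m; elim: m W s => [|m IHm] W s Wm sW.
  exists (fun=> i0) => i; move: sW; rewrite Wm => /eqP; rewrite sum_nat_eq0.
  move=> /forallP/(_ i)/eqP->; apply/eqP; rewrite cards_eq0.
  by rewrite (cards0_eq Wm); apply/eqP/setP=> u; rewrite !inE.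
have /set0Pn[u uW] : W != set0 by rewrite -cards_eq0 Wm.
have [i si] : exists i, 0 < s i.
  apply/existsP; apply: contraPT sW => /existsPn s0.
  by rewrite big1 ?Wm // => i _; apply/eqP; rewrite -leqn0 leqNgt.
pose s' j := s j - (j == i).
have sE j : s j = s' j + (j == i).
  by rewrite /s' subnK //; case: eqP => // ->.
have cW : #|W :\ u| = m by move: Wm; rewrite (cardsD1 u) uW => -[].
have [|phi phiP] := IHm (W :\ u) s' cW.
  move: sW; under eq_bigr do rewrite sE.
  rewrite big_split /= [X in _ + X](bigD1 i) //= eqxx.
  rewrite [X in _ + (_ + X)]big1 => [|j /negbTE-> //].
  by rewrite Wm cW addn0 addn1 => -[].
exists (fun x => if x == u then i else phi x) => j.
rewrite sE -phiP (cardsD1 u) !inE uW eqxx /= eq_sym addnC; congr (_ + _).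
by apply: eq_card => x; rewrite !inE; case: eqP.
Qed.

Definition level Ls u := find (fun A : {set V} => u \in A) Ls.

Lemma in_ucov_cons (A : {set V}) Ls u :
  (u \in ucov (A :: Ls)) = (u \in A) || (u \in ucov Ls).
Proof. by rewrite ucov_cons inE. Qed.

Lemma level_lt Ls u : u \in ucov Ls -> level Ls u < size Ls.
Proof.
elim: Ls => [|A Ls IH]; first by rewrite /ucov big_nil inE.
by rewrite in_ucov_cons /level /=; case: (u \in A) => //= /IH.
Qed.

Lemma nth_sub_ucov Ls j : nth set0 Ls j \subset ucov Ls.
Proof.
elim: Ls j => [|A Ls IH] [|j] /=; rewrite ?sub0set // ucov_cons ?subsetUl //.
by apply: subset_trans (IH j) _; exact: subsetUr.
Qed.

Lemma level_eq Ls u j : chain F Ls -> u \in ucov Ls ->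
  (level Ls u == j) = (u \in nth set0 Ls j).
Proof.
elim: Ls j => [|A Ls IH] j; first by rewrite /ucov big_nil inE.
case=> _ disA _ chLs; rewrite in_ucov_cons /level /=.
have [uA _|uA /=] := boolP (u \in A).
  case: j => [|j] /=; first by rewrite uA.
  symmetry; apply/negbTE; apply: contraL uA => /(subsetP (nth_sub_ucov Ls j)) uL.
  by rewrite (disjointFl disA).
by case: j => [|j] uL /=; [rewrite (negbTE uA) | rewrite eqSS; exact: IH].
Qed.

Lemma card_ucov Ls : chain F Ls ->
  #|ucov Ls| + 3 * count_mem set0 Ls = 3 * size Ls.
Proof.
elim: Ls => [|A Ls IH]; first by rewrite /ucov big_nil cards0.
case=> A03 disA _ /IH{}IH.
rewrite ucov_cons cardsU (disjoint_setI0 disA) cards0 subn0 /= mulnS -IH mulnDr.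
case: A03 => [->|A3]; first by rewrite eqxx cards0 muln1 add0n addnCA.
have -> : (A == set0) = false by rewrite -cards_eq0 A3.
by rewrite A3 muln0 add0n addnA.
Qed.

Lemma chain_card Ls j : chain F Ls ->
  (#|nth set0 Ls j| == 0) || (#|nth set0 Ls j| == 3).
Proof.
elim: Ls j => [|A Ls IH] [|j] /=; rewrite ?cards0 //; last by move=> [_ _ _ /IH].
by move=> [[->|->] _ _ _]; rewrite ?cards0.
Qed.

Lemma chain_adj Ls u w : chain F Ls -> u \in ucov Ls -> w \in ucov Ls ->
  level Ls u != level Ls w ->
  F u w = (level Ls w == (level Ls u).+1) || (level Ls u == (level Ls w).+1).
Proof.
elim: Ls => [|A Ls IH]; first by rewrite /ucov big_nil inE.
case=> _ _ adjA chLs; rewrite !in_ucov_cons /level /=.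
have headE x : x \in ucov Ls -> (x \in head set0 Ls) = (level Ls x == 0).
  case: Ls {IH chLs adjA} => [|B Ls]; first by rewrite /ucov big_nil inE.
  by move=> _; rewrite /level /=; case: ifP.
have [uA|uA] := boolP (u \in A); have [wA|wA] := boolP (w \in A) => //= uL wL neq.
- by rewrite (adjA u w) // headE // eqSS orbF.
- by rewrite adjacent_sym (adjA w u) // headE // eqSS.
by rewrite eqSS in neq; rewrite !eqSS; exact: IH.
Qed.

Section Braid.
Variables (k : nat) (pos : V -> 'I_k).
Hypotheses (k3 : 3 <= k) (pos_surj : forall i, exists u, pos u = i).

Definition braid_graph : sgraph V :=
  graph_of (fun u w => if pos u == pos w then F u w else pos w == ordS (pos u)).

Lemma braid_graphE u w : braid_graph u w =
  if pos u == pos w then F u w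
  else (pos w == ordS (pos u)) || (pos u == ordS (pos w)).
Proof.
rewrite graph_ofE; have [->|nuw] := eqVneq u w.
  by rewrite eqxx adjacent_irrefl.
rewrite (eq_sym (pos w) (pos u)); case: ifP => //= _.
by rewrite (adjacent_sym F w) orbb.
Qed.

Lemma braid_graph_cyclic :
  cyclic_braid_with braid_graph (fun i => [set u | pos u == i]).
Proof.
have selfS (j : 'I_k) : (ordS j == j) = false.
  by apply/negbTE; rewrite ordS_neq // ltnW.
split=> //.
- split.
    move=> i j /setP eB; have [u ui] := pos_surj i.
    by have := eB u; rewrite !inE ui eqxx => /esym/eqP.
  apply/and3P; split.
  + apply/eqP/setP=> u; rewrite inE; apply/bigcupP.
    by exists [set w | pos w == pos u]; rewrite ?imset_f ?inE.
  + apply/trivIsetP => _ _ /imsetP[i _ ->] /imsetP[j _ ->] nij.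
    rewrite -setI_eq0; apply/eqP/setP=> u; rewrite !inE.
    by apply/negP=> /andP[/eqP ei /eqP ej]; move: nij; rewrite -ei -ej eqxx.
  + apply/imsetP => -[i _ /setP e0]; have [u ui] := pos_surj i.
    by have := e0 u; rewrite !inE ui eqxx.
move=> i x; rewrite inE => /eqP xi.
split; apply/subsetP=> y; rewrite !inE braid_graphE xi.
  case/orP=> /eqP->; last by rewrite eq_sym selfS eqxx.
  by rewrite -{1}(ord_predK i) selfS ord_predK eqxx orbT.
have [->|_] := eqVneq i (pos y); first by rewrite orbT.
by case/orP=> /eqP->; rewrite ?ordSK eqxx ?orbT.
Qed.

End Braid.

Lemma sum_H_size n : 8 <= n -> \sum_(i < H_length n) H_size n i = n.
Proof.
move=> n8; rewrite -[RHS](card_H_vertex n8) card_tagged sumnE big_map big_enum /=.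
by apply: eq_bigr => i _; rewrite card_ord.
Qed.

Lemma sum_fibers k (q : V -> 'I_k) (A : {set V}) :
  \sum_i #|[set u in A | q u == i]| = #|A|.
Proof.
rewrite -[RHS]sum1_card (partition_big q xpredT) //=.
by apply: eq_bigr => i _; rewrite -sum1_card; apply: eq_bigl => u; rewrite inE.
Qed.

Lemma braid_of_chain n Ls : 8 <= n -> #|V| = n -> chain F Ls ->
  3 * count_mem set0 Ls + 2 <= #|~: ucov Ls| ->
  exists (F' : sgraph V) (B : 'I_(H_length n) -> {set V}),
    [/\ forall u w, u \in ucov Ls -> w \in ucov Ls -> F' u w = F u w,
        cyclic_braid_with F' B
      & perm_eq (cluster_sizes B) (cluster_sizes (H_cluster n))].
Proof.
move=> n8 cardV chLs holes; have sumH := sum_H_size n8.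
have k3 : 3 <= H_length n by rewrite leq_divRL.
have size_lt : (size Ls).+1 <= H_length n.
  have := card_ucov chLs; have := cardsC (ucov Ls); rewrite cardV.
  by rewrite leq_divRL //; move: holes; clear; lia.
set k := H_length n in k3 size_lt sumH *.
pose i0 : 'I_k := Ordinal (ltnW (ltnW k3)).
pose q u : 'I_k := insubd i0 (level Ls u).+1.
have qE u : u \in ucov Ls -> q u = (level Ls u).+1 :> nat.
  move=> uL; rewrite val_insubd (_ : _ < k) //.
  by apply: leq_trans size_lt; exact: level_lt.
have fib_le i : #|[set u in ucov Ls | q u == i]| <= H_size n i.
  case: i => -[|j] ltj.
    rewrite eq_card0 // => u; rewrite inE; apply/negP => /andP[/qE qu /eqP q0].
    by rewrite q0 in qu.
  rewrite (_ : [set _ in _ | _] = nth set0 Ls j).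
    by rewrite /H_size /=; case/orP: (chain_card j chLs) => /eqP->.
  apply/setP=> u; rewrite inE; have [uL|uL] := boolP (u \in ucov Ls).
    by rewrite -val_eqE /= qE // eqSS level_eq.
  by symmetry; apply: contraNF uL => /(subsetP (nth_sub_ucov Ls j)).
have [phi phiP] : exists phi : V -> 'I_k, forall i,
    #|[set u in ~: ucov Ls | phi u == i]| =
      H_size n i - #|[set u in ucov Ls | q u == i]|.
  apply: fiber_function => //; apply/eqP.
  rewrite -(eqn_add2l #|ucov Ls|) cardsC -(sum_fibers q) -big_split /= cardV -[X in _ == X]sumH.
  by apply/eqP/eq_bigr => i _; rewrite subnKC.
pose pos u := if u \in ucov Ls then q u else phi u.
have card_pos i : #|[set u | pos u == i]| = H_size n i.
  rewrite -(subnKC (fib_le i)) -phiP -(cardsID (ucov Ls) [set u | pos u == i]).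
  congr (_ + _); apply: eq_card => u; rewrite !inE /pos; first by case: ifP; rewrite ?andbF ?andbT.
  by case: ifP.
have pos_surj i : exists u, pos u = i.
  have /set0Pn[u] : [set u | pos u == i] != set0.
    rewrite -card_gt0 card_pos /H_size; case: eqP => // _.
    by case: (n %% 3) => [|[|]].
  by rewrite inE => /eqP <-; exists u.
(* Position 0 contains only exceptional vertices, so that the cyclic closing of
   the chain creates no adjacency between vertices of the chain. *)
exists (braid_graph pos), (fun i => [set u | pos u == i]); split.
- move=> u w uL wL; rewrite braid_graphE /pos uL wL -!val_eqE /= !qE // eqSS.
  case: eqVneq => // neq; rewrite (chain_adj chLs uL wL neq).
  have lu := level_lt uL; have lw := level_lt wL.
  have ordE a c : a < size Ls -> c < size Ls -> (c.+1 == a.+2 %% k) = (c == a.+1).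
    move=> ac cc; have [lt|ge] := ltnP a.+2 k; first by rewrite modn_small.
    have -> : a.+2 = k by apply/eqP; rewrite eqn_leq ge andbT (leq_trans _ size_lt).
    rewrite modnn; symmetry; apply/negbTE; rewrite neq_ltn (leq_trans cc) //.
    by rewrite -ltnS (leq_trans size_lt).
  by rewrite !ordE.
- exact: braid_graph_cyclic.
rewrite (_ : cluster_sizes _ = cluster_sizes (H_cluster n)) //.
by apply: eq_map => i; rewrite card_pos card_H_cluster.
Qed.

End Assembly.

Section LowerBound.
Local Open Scope nat_scope.

Lemma induces_cycleI (V : finType) (G : sgraph V) m (h : 'I_m -> V) :
  3 <= m -> injective h -> (forall i j, G (h i) (h j) = cycle_graph m i j) ->
  induces_cycle G (h @: [set: 'I_m]).
Proof.
move=> m3 injh adjh; have cS : #|h @: [set: 'I_m]| = m by rewrite card_imset // cardsT card_ord.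
rewrite /induces_cycle cS m3 /=; apply/existsP.
have : exists f : {ffun 'I_m -> V}, [&& injectiveb f, f @: [set: 'I_m] == h @: [set: 'I_m]
    & [forall i, forall j, G (f i) (f j) == cycle_graph m i j]].
  exists [ffun i => h i]; apply/and3P; split.
  - by apply/injectiveP => i j; rewrite !ffunE => /injh.
  - by apply/eqP/eq_imset => i; rewrite ffunE.
  by apply/forallP => i; apply/forallP => j; rewrite !ffunE adjh.
by [].
Qed.

Lemma max_induced_cycles_ge n : 9 <= n -> 3 ^ (n %/ 3) <= max_induced_cycles n.
Proof.
move=> n9; set k := n %/ 3; have k3 : 3 <= k by rewrite leq_divRL.
have kn : 3 * k <= n by rewrite mulnC leq_trunc_div.
pose G : sgraph 'I_n := graph_of (fun u w : 'I_n =>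
  [&& u < 3 * k, w < 3 * k & w %/ 3 == (u %/ 3).+1 %% k]).
have lt_n (g : {ffun 'I_k -> 'I_3}) (i : 'I_k) : 3 * i + g i < 3 * k.
  have := ltn_ord i; have := ltn_ord (g i); clear; lia.
pose h (g : {ffun 'I_k -> 'I_3}) (i : 'I_k) : 'I_n := Ordinal (leq_trans (lt_n g i) kn).
have hdiv g i : h g i %/ 3 = i.
  by rewrite /= mulnC divnMDl // divn_small ?addn0.
have hmod g i : h g i %% 3 = g i by rewrite /= mulnC modnMDl modn_small.
have hinj g : injective (h g).
  by move=> i j eqh; apply: val_inj; rewrite /= -(hdiv g i) eqh hdiv.
have cyc g : induces_cycle G (h g @: [set: 'I_k]).
  apply: induces_cycleI => // i j; rewrite !graph_ofE (inj_eq (hinj g)).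
  by rewrite !hdiv /= !lt_n -!val_eqE /=.
apply: leq_trans (leq_bigmax G).
have <- : #|{ffun 'I_k -> 'I_3}| = 3 ^ k by rewrite card_ffun !card_ord.
rewrite -cardsT -(card_imset _ (f := fun g => h g @: [set: 'I_k])).
  apply: subset_leq_card; apply/subsetP => _ /imsetP[g _ ->].
  by rewrite inE.
move=> g g' eqhg; apply/ffunP=> i; apply: val_inj.
have /imsetP[j _ eqij] : h g i \in h g' @: [set: 'I_k] by rewrite -eqhg imset_f.
have ij : i = j by apply: val_inj; rewrite /= -(hdiv g i) eqij hdiv.
by rewrite /= -(hmod g i) eqij hmod ij.
Qed.

End LowerBound.

Theorem theorem1p5 (R : realType) (alpha : R) :
  0 < alpha -> alpha < 1 ->
  exists C n0 : nat,
    forall n : nat, (n0 <= n)%N ->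
    forall (V : finType) (F : sgraph V), #|V| = n ->
      alpha * (max_induced_cycles n)%:R <= (num_induced_cycles F)%:R ->
      exists (W : {set V}) (F' : sgraph V) (k : nat) (B : 'I_k -> {set V}),
        [/\ (#|W| <= C)%N,
            forall x y : V, x \notin W -> y \notin W -> F' x y = F x y,
            cyclic_braid_with F' B
          & perm_eq (cluster_sizes B) (cluster_sizes (H_cluster n))].
Proof.
move=> alpha0 alpha1; have [th th_gt0 th3] := cube_root_3 R.
have th2 : 0 < th ^+ 2 by rewrite exprn_gt0.
have c0 : 0 < alpha / th ^+ 2 by rewrite divr_gt0.
have [C [n0 chainP]] := cluster_chain th_gt0 th3 c0.
exists C, (n0 + 9)%N => n n_large V F cardV many.
have n9 : (9 <= n)%N := leq_trans (leq_addl _ _) n_large.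
have [||Ls [chLs holes leC]] := chainP V F.
- by rewrite cardV (leq_trans (leq_addr _ _) n_large).
- rewrite cardV; apply: le_trans many; rewrite -mulrA ler_pM2l // mulrC ler_pdivrMr //.
  apply: (@le_trans _ _ ((3 ^ (n %/ 3))%:R * th ^+ 2)); last first.
    by rewrite ler_pM2r // ler_nat max_induced_cycles_ge.
  rewrite natrX -th3 -exprM -exprD ler_weXn2l ?(th_ge1 th_gt0 th3) //.
  by rewrite {1}(divn_eq n 3) mulnC leq_add2l -ltnS ltn_pmod.
have [|F' [B [eqF braid sizes]]] := braid_of_chain _ cardV chLs holes.
  exact: ltnW.
exists (~: ucov Ls), F', (H_length n), B; split=> //.
by move=> x y; rewrite !inE !negbK; exact: eqF.
Qed.
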